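(* Let $G$ be a finite group, $N$ a normal subgroup of $G$, $J=J(F[N])$ and $I=\{\alpha\in F[G]\mid J\alpha=0\}$. Let $P_1,\dots,P_l$ be a complete set of representatives of the isomorphism classes of principal indecomposable right $F[G]$-modules, let $(c_{ij})$ be the Cartan matrix of $F[G]$, $(\overline{c_{ij}})$ the Cartan matrix of $F[G/N]$, $(x_{ij})$ the Cartan matrix of $F[G]/I$, and $(a_{ij})$ the Cartan matrix of $F[G]/F[G]J$, all indexed by the $P_i$ as described in the context. Let $S_1$ be the set of those $P_i$ whose head is a simple module of $G/N$, and $S_2$ the set of the remaining $P_i$. Then: \begin{enumerate} \item If $P_i,P_j\in S_1$, then $c_{ij}=\overline{c_{ij}}+x_{ij}$. \item If $P_j\in S_1$ and $P_i\in S_2$, then $c_{ij}=x_{ij}$. \item If $P_i,P_j\in S_2$, then $c_{ij}=a_{ij}+x_{ij}$. \end{enumerate}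
   Context: $F$ is a field of characteristic $p>0$ that is a splitting field for the groups considered. $J(R)$ denotes the Jacobson radical of a ring $R$. The set $I$ is a two-sided ideal of $F[G]$, and $F[G]J$ is a two-sided ideal of $F[G]$. $\mathrm{Hd}(P)=P/PJ(F[G])$ is the head of $P$; it is a simple module of $G/N$ if $N$ acts trivially on it. The principal indecomposable modules are regarded as right ideals $P_i\subseteq F[G]$. Cartan numbers: - $c_{ij}$ is the multiplicity of $\mathrm{Hd}(P_j)$ as a composition factor of $P_i$. - For $P_i,P_j\in S_1$, $\overline{c_{ij}}$ is the multiplicity of $\mathrm{Hd}(P_j)$ as a composition factor of the projective $F[G/N]$-cover of $\mathrm{Hd}(P_i)$ (this cover is $P_i/P_iJ$). - $x_{ij}$ is the multiplicity of $\mathrm{Hd}(P_j)$ as a composition factor of $P_i/(P_i\cap I)$ (so the Cartan numbers $x_{ij}$ related to a $P_i$ or $P_j$ contained in $I$ are zero). - $a_{ij}$ is the multiplicity of $\mathrm{Hd}(P_j)$ as a composition factor of $P_i/P_iJ$, the projective $F[G]/F[G]J$-cover of $\mathrm{Hd}(P_i)$. *)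

(* Defs.v *)
From HB Require Import structures.
From mathcomp Require Import all_boot all_order all_algebra all_fingroup.
From mathcomp Require Import mxrepresentation.
From mathcomp Require Import boolp.

(* Conventions.  The group algebra F[G] acts on itself by right multiplication;
   with the MathComp row-vector convention this is [regular_repr F G], acting on
   'rV_#|G| on the right.  An element of F[G] is represented either by a row
   vector v of length #|G| or by the matrix [gring_mx (regular_repr F G) v] of
   right multiplication by it, an element of the matrix algebra
   [group_ring F G]; v |-> gring_mx v is multiplicative, in this order.  Right
   F[G]-modules are matrix representations, and right ideals of F[G] are the row
   spaces U with [mxmodule (regular_repr F G) U]. *)

Set Implicit Arguments.
Unset Strict Implicit.
Unset Printing Implicit Defensive.

Import GRing.Theory.
Local Open Scope ring_scope.

Section Span.

Variables (F : fieldType) (n : nat).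

Lemma mxspan_exists (P : 'rV[F]_n -> Prop) :
  exists U : 'M[F]_n, (forall v, P v -> (v <= U)%MS) /\
    (forall V : 'M[F]_n, (forall v, P v -> (v <= V)%MS) -> (U <= V)%MS).
Proof.
pose Q (U : 'M[F]_n) := forall v, P v -> (v <= U)%MS.
pose q k := `[< exists2 U, Q U & \rank U = k >].
have exq : exists k, q k.
  by exists (\rank (1%:M : 'M[F]_n)); apply/asboolP; exists 1%:M => // v _;
     apply: submx1.
have [k /asboolP[U QU rU] minU] := ex_minnP exq.
exists U; split=> // V QV.
have /minU : q (\rank (U :&: V)%MS).
  apply/asboolP; exists (U :&: V)%MS => // v Pv.
  by rewrite sub_capmx QU ?QV.
rewrite -rU => leUV; apply: submx_trans (capmxSr U V).
by rewrite -(geq_leqif (mxrank_leqif_sup (capmxSl U V))).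
Qed.

(* The linear span of P, i.e. the smallest row space containing every v with
   P v. *)
Definition mxspan (P : 'rV[F]_n -> Prop) : 'M[F]_n :=
  sval (cid (mxspan_exists P)).

Lemma mxspan_mem (P : 'rV[F]_n -> Prop) v : P v -> (v <= mxspan P)%MS.
Proof. by rewrite /mxspan; case: cid => U [/= QU _]; apply: QU. Qed.

Lemma mxspan_min m (P : 'rV[F]_n -> Prop) (V : 'M[F]_(m, n)) :
  (forall v, P v -> (v <= V)%MS) -> (mxspan P <= V)%MS.
Proof.
rewrite /mxspan; case: cid => U [/= _ minU] PV.
by rewrite -(genmxE V); apply: minU => v /PV; rewrite genmxE.
Qed.

Lemma mxspan_stable (P : 'rV[F]_n -> Prop) (A : 'M[F]_n) :
  (forall v, P v -> P (v *m A)) -> (mxspan P *m A <= mxspan P)%MS.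
Proof.
move=> PA; rewrite submxE -mulmxA; apply/eqP/sub_kermxP.
apply: mxspan_min => v /PA/mxspan_mem.
by rewrite submxE -mulmxA => /eqP/sub_kermxP.
Qed.

End Span.

Section JacobsonRadical.

Variables (F : fieldType) (n m : nat) (R : 'A[F]_(m, n)).
Local Open Scope matrix_set_scope.

Definition maximal_right_ideal (M : 'A[F]_n) : Prop :=
  [/\ (M < R)%MS, right_mx_ideal R M
    & forall L : 'A[F]_n, (L <= R)%MS -> right_mx_ideal R L -> (M < L)%MS ->
        (R <= L)%MS].

Definition jacobson_radical : 'A[F]_n :=
  mxspan (fun v => (v <= R)%MS /\
                   forall M, maximal_right_ideal M -> (v <= M)%MS).

Lemma jacobson_radicalP (v : 'rV_(n ^ 2)) :
  (v <= jacobson_radical)%MS <->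
  (v <= R)%MS /\ forall M, maximal_right_ideal M -> (v <= M)%MS.
Proof.
split=> [Jv | ]; last exact: mxspan_mem.
split=> [|M maxM]; apply: (submx_trans Jv); apply: mxspan_min => w [] // _.
exact.
Qed.

Lemma jacobson_radical_right A B :
    (forall A B : 'M_n, (A \in R)%MS -> (B \in R)%MS -> (A *m B \in R)%MS) ->
  (A \in jacobson_radical)%MS -> (B \in R)%MS ->
  (A *m B \in jacobson_radical)%MS.
Proof.
move=> mulR /jacobson_radicalP[RA maxA] RB; apply/jacobson_radicalP.
split=> [|M maxM]; first exact: mulR.
have [_ rightM _] := maxM; exact: (mulsmx_subP rightM) (maxA M maxM) RB.
Qed.

End JacobsonRadical.

Section Conjugation.

Variables (F : fieldType) (n m : nat) (R : 'A[F]_(m, n)) (X Y : 'M[F]_n).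
Hypotheses (XY : X *m Y = 1%:M) (YX : Y *m X = 1%:M).
Hypothesis conjR : forall A : 'M_n, (A \in R)%MS = (Y *m A *m X \in R)%MS.

Let conj : 'M[F]_(n * n) := lin_mulmx Y *m lin_mulmxr X.
Let unconj : 'M[F]_(n * n) := lin_mulmx X *m lin_mulmxr Y.

Let mul_conj A : mxvec A *m conj = mxvec (Y *m A *m X).
Proof. by rewrite /conj mulmxA !mul_vec_lin. Qed.

Let mul_unconj A : mxvec A *m unconj = mxvec (X *m A *m Y).
Proof. by rewrite /unconj mulmxA !mul_vec_lin. Qed.

Let conjK : conj *m unconj = 1%:M.
Proof.
apply/row_matrixP=> i; rewrite row_mul -[row i conj]mulmx1 -row_mul mulmx1.
rewrite rowE -[delta_mx _ _]vec_mxK mul_conj mul_unconj !mulmxA XY mul1mx.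
by rewrite -mulmxA XY mulmx1 vec_mxK row1.
Qed.

Let unconjK : unconj *m conj = 1%:M.
Proof. exact: mulmx1C conjK. Qed.

Let memJ k (S : 'A[F]_(k, n)) A :
  (A \in S *m unconj)%MS = (Y *m A *m X \in S)%MS.
Proof.
rewrite -mul_conj; apply/idP/idP=> [/(submxMr conj)|/(submxMr unconj)].
  by rewrite -mulmxA unconjK mulmx1.
by rewrite -mulmxA conjK mulmx1.
Qed.

Let memJ' k (S : 'A[F]_(k, n)) A :
  (A \in S *m conj)%MS = (X *m A *m Y \in S)%MS.
Proof.
rewrite -mul_unconj; apply/idP/idP=> [/(submxMr unconj)|/(submxMr conj)].
  by rewrite -mulmxA conjK mulmx1.
by rewrite -mulmxA unconjK mulmx1.
Qed.

Let eqR : (R *m unconj :=: R)%MS.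
Proof.
by apply/eqmxP/andP; split; apply/memmx_subP=> A; rewrite memJ -conjR.
Qed.

Let eqR' : (R *m conj :=: R)%MS.
Proof.
apply: eqmx_trans (eqmxMr conj (eqmx_sym eqR)) _.
by rewrite -mulmxA unconjK mulmx1.
Qed.

Let rightJ (M : 'A[F]_n) :
  right_mx_ideal R M -> right_mx_ideal R (M *m unconj).
Proof.
move=> rM; apply/mulsmx_subP=> A B; rewrite !memJ => MA RB.
have -> : Y *m (A *m B) *m X = (Y *m A *m X) *m (Y *m B *m X).
  by rewrite -!mulmxA (mulmxA X Y) XY mul1mx.
by apply: (mulsmx_subP rM); rewrite -?conjR.
Qed.

Let rightJ' (M : 'A[F]_n) :
  right_mx_ideal R M -> right_mx_ideal R (M *m conj).
Proof.
move=> rM; apply/mulsmx_subP=> A B; rewrite !memJ' => MA RB.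
have -> : X *m (A *m B) *m Y = (X *m A *m Y) *m (X *m B *m Y).
  by rewrite -!mulmxA (mulmxA Y X) YX mul1mx.
apply: (mulsmx_subP rM) => //.
by rewrite conjR -!mulmxA YX mulmx1 !mulmxA YX mul1mx.
Qed.

Lemma maximal_right_idealJ (M : 'A[F]_n) :
  maximal_right_ideal R M -> maximal_right_ideal R (M *m unconj).
Proof.
move=> [ltMR rM maxM]; split; last first.
- move=> L sLR rL ltML; have: (R <= L *m conj)%MS.
    apply: maxM; first by rewrite -eqR' submxMr.
      exact: rightJ'.
    move: ltML; rewrite /ltmx => /andP[sML /negP nLM]; apply/andP; split.
      by move/(submxMr conj): sML; rewrite -mulmxA unconjK mulmx1.
    apply/negP=> /(submxMr unconj); rewrite -mulmxA conjK mulmx1; exact: nLM.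
  by move/(submxMr unconj); rewrite -mulmxA conjK mulmx1 eqR.
- exact: rightJ.
move: ltMR; rewrite /ltmx => /andP[sMR /negP nRM]; apply/andP; split.
  by rewrite -eqR submxMr.
apply/negP=> /(submxMr conj); rewrite -mulmxA unconjK mulmx1 eqR'; exact: nRM.
Qed.

Lemma jacobson_radicalJ A :
  (A \in jacobson_radical R)%MS -> (Y *m A *m X \in jacobson_radical R)%MS.
Proof.
move=> /jacobson_radicalP[RA maxA]; apply/jacobson_radicalP.
split=> [|M maxM]; first by rewrite -conjR.
by rewrite -memJ; apply/maxA/maximal_right_idealJ.
Qed.

End Conjugation.

Section Composition.

Variables (F : fieldType) (gT : finGroupType) (G : {group gT}).

Section Series.

Variables (n : nat) (rG : mx_representation F G n).

Lemma full_series_exists :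
  exists U : seq 'M[F]_n,
    mx_composition_series rG U /\ (last 0 U :=: 1%:M)%MS.
Proof.
apply: contrapT => noU.
suff: false by [].
apply: (@mx_Schreier F gT G n rG [::]) => // -[U [compU lastU _]].
by case: noU; exists U.
Qed.

Definition series_mult (U : seq 'M[F]_n) (compU : mx_composition_series rG U)
    (k : nat) (rS : mx_representation F G k) : nat :=
  (\sum_(i < size U) `[< mx_rsim (series_repr i compU) rS >])%N.

(* By [comp_multE] the value does not depend on the chosen series. *)
Definition comp_mult (k : nat) (rS : mx_representation F G k) : nat :=
  series_mult (proj1 (svalP (cid full_series_exists))) rS.

Lemma comp_multE (U : seq 'M[F]_n) (compU : mx_composition_series rG U)
    (k : nat) (rS : mx_representation F G k) :
  (last 0 U :=: 1%:M)%MS -> comp_mult rS = series_mult compU rS.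
Proof.
rewrite /comp_mult; move: (cid _) => c; have [_ lastV] := svalP c.
move: (sval c) (proj1 _) lastV => V compV lastV lastU.
have [] := mx_JordanHolder compV compU.
  exact: eqmx_trans lastV (eqmx_sym lastU).
rewrite /series_mult => eqVU [s simVU].
rewrite -(big_mkord xpredT (fun i =>
  nat_of_bool `[< mx_rsim (series_repr i compU) rS >])) -eqVU big_mkord.
rewrite [RHS](reindex_inj (@perm_inj _ s)) /=; apply: eq_bigr => i _.
congr (nat_of_bool _); apply/asboolP/asboolP.
  move=> simVS; apply: mx_rsim_trans simVS.
  by apply: mx_rsim_sym; apply: simVU.
by move=> simUS; apply: mx_rsim_trans simUS; apply: simVU.
Qed.

End Series.

End Composition.

Section ProjectiveCover.

Variables (F : fieldType) (gT : finGroupType) (G : {group gT}).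

Definition repr_hom m (rM : mx_representation F G m)
    k (rK : mx_representation F G k) (f : 'M[F]_(m, k)) : Prop :=
  forall x, x \in G -> rM x *m f = f *m rK x.

Definition repr_projective n (rP : mx_representation F G n) : Prop :=
  forall m (rM : mx_representation F G m) k (rK : mx_representation F G k)
         (f : 'M[F]_(m, k)) (g : 'M[F]_(n, k)),
    repr_hom rM rK f -> row_full f -> repr_hom rP rK g ->
    exists h : 'M[F]_(n, m), repr_hom rP rM h /\ h *m f = g.

Definition superfluous n (rP : mx_representation F G n) (K : 'M[F]_n) : Prop :=
  forall U : 'M[F]_n, mxmodule rP U -> row_full (U + K)%MS -> row_full U.

Definition projective_cover n (rP : mx_representation F G n)
    k (rS : mx_representation F G k) : Prop :=
  repr_projective rP /\
  exists f : 'M[F]_(n, k),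
    [/\ repr_hom rP rS f, row_full f & superfluous rP (kermx f)].

(* The multiplicity of rT as a composition factor of the projective cover of
   rS; covers exist and are unique up to isomorphism, so the default value 0
   and the choice of the cover are immaterial. *)
Definition cover_mult k (rS : mx_representation F G k)
    l (rT : mx_representation F G l) : nat :=
  match pselect (exists nP : {n & mx_representation F G n},
                   projective_cover (projT2 nP) rS) with
  | left exP => comp_mult (projT2 (sval (cid exP))) rT
  | right _ => 0%N
  end.

End ProjectiveCover.

Section GroupAlgebra.

Variables (F : fieldType) (gT : finGroupType) (G : {group gT}).
Local Notation aG := (regular_repr F G).
Local Notation nG := (gcard G).

Definition mul_ideal (U : 'M[F]_nG) (J : 'A[F]_nG) : 'M[F]_nG :=
  mxspan (fun w => exists u, exists A,
    [/\ (u <= U)%MS, (A \in J)%MS & w = u *m A]).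

Lemma mul_ideal_module (U : 'M[F]_nG) (J : 'A[F]_nG) :
    (forall A x, (A \in J)%MS -> x \in G ->
       exists u B, [/\ A *m aG x = u *m B, (B \in J)%MS
                     & forall v : 'rV_nG, (v <= U)%MS -> (v *m u <= U)%MS]) ->
  mxmodule aG (mul_ideal U J).
Proof.
move=> JG; apply/mxmoduleP=> x Gx.
apply: mxspan_stable => _ [u [A [Uu JA ->]]].
have [v [B [AxE JB Uv]]] := JG A x JA Gx.
by exists (u *m v), B; rewrite -mulmxA AxE mulmxA; split=> //; apply: Uv.
Qed.

Definition right_annihilator (J : 'A[F]_nG) : 'M[F]_nG :=
  mxspan (fun v => forall A, (A \in J)%MS -> A *m gring_mx aG v = 0).

Lemma right_annihilator_module J : mxmodule aG (right_annihilator J).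
Proof.
apply/mxmoduleP=> x Gx; apply: mxspan_stable => v Jv A JA.
by rewrite gring_mxJ // mulmxA Jv // mul0mx.
Qed.

Definition radFG : 'A[F]_nG := jacobson_radical (group_ring F G).

Definition indecomposable (U : 'M[F]_nG) : Prop :=
  U != 0 /\
  forall V W : 'M[F]_nG, mxmodule aG V -> mxmodule aG W ->
    (V + W :=: U)%MS -> mxdirect (V + W) -> V = 0 \/ W = 0.

Record pim := Pim {
  pim_mx :> 'M[F]_nG;
  pim_module : mxmodule aG pim_mx;
  pim_summand : mxsplits aG 1%:M pim_mx;
  pim_indecomposable : indecomposable pim_mx
}.

Lemma mul_radFG_module (P : pim) : mxmodule aG (mul_ideal P radFG).
Proof.
apply: mul_ideal_module => A x JA Gx.
exists 1%:M, (A *m aG x); split=> [||v Uv]; rewrite ?mul1mx ?mulmx1 //.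
apply: jacobson_radical_right => // [B C|]; first exact: envelop_mxM.
exact: envelop_mx_id.
Qed.

(* The quotient P / P J(F[G]). *)
Definition head (P : pim) :=
  section_repr (mul_radFG_module P) (pim_module P).

Definition complete_pims (l : nat) (P : 'I_l -> pim) : Prop :=
  (forall i j, mx_iso aG (P i) (P j) -> i = j) /\
  (forall Q : pim, exists i, mx_iso aG Q (P i)).

Definition cartan (P Q : pim) : nat :=
  comp_mult (submod_repr (pim_module P)) (head Q).

Section NormalSubgroup.

Variables (N : {group gT}) (nsNG : (N <| G)%g).
Let sNG : N \subset G := normal_sub nsNG.
Let nNG : (G \subset 'N(N))%g := normal_norm nsNG.

(* F[N] as the F-span of N inside F[G]. *)
Definition subgroup_ring : 'A[F]_(#|N|, nG) :=
  enveloping_algebra_mx (subg_repr aG sNG).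

Definition radFN : 'A[F]_nG := jacobson_radical subgroup_ring.

Lemma subgroup_ring_conj x A : x \in G -> (A \in subgroup_ring)%MS ->
  (aG x^-1%g *m A *m aG x \in subgroup_ring)%MS.
Proof.
move=> Gx /envelop_mxP[a ->].
rewrite mulmx_sumr mulmx_suml linear_sum summx_sub //= => y Ny.
have Gy : y \in G by apply: (subsetP sNG).
rewrite -scalemxAr -scalemxAl linearZ scalemx_sub //=.
rewrite -repr_mxM ?groupV // -repr_mxM ?groupM ?groupV //.
have -> : (x^-1 * y * x = y ^ x)%g by rewrite conjgE mulgA.
by apply: (envelop_mx_id (subg_repr aG sNG)); rewrite memJ_norm ?(subsetP nNG).
Qed.

Lemma radFN_conj x A : x \in G -> (A \in radFN)%MS ->
  (aG x^-1%g *m A *m aG x \in radFN)%MS.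
Proof.
move=> Gx.
have XY y : y \in G -> aG y *m aG y^-1%g = 1%:M.
  by move=> Gy; rewrite -repr_mxM ?groupV // mulgV repr_mx1.
have YX : aG x^-1%g *m aG x = 1%:M by rewrite -repr_mxM ?groupV // mulVg repr_mx1.
apply: jacobson_radicalJ; rewrite ?XY // => B.
apply/idP/idP=> [|RB]; first exact: subgroup_ring_conj.
have := @subgroup_ring_conj x^-1%g _ (groupVr Gx) RB.
by rewrite invgK !mulmxA XY // mul1mx -mulmxA XY // mulmx1.
Qed.

Lemma mul_radFN_module (P : pim) : mxmodule aG (mul_ideal P radFN).
Proof.
apply: mul_ideal_module => A x JA Gx.
exists (aG x), (aG x^-1%g *m A *m aG x); split.
- by rewrite !mulmxA -repr_mxM ?groupV // mulgV repr_mx1 mul1mx.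
- exact: radFN_conj.
- by move=> v Uv; apply: mxmodule_trans Uv => //; apply: pim_module.
Qed.

Definition annFN : 'M[F]_nG := right_annihilator radFN.

(* Multiplicity of the head of Q in P / (P \cap I). *)
Definition cartan_mod_annFN (P Q : pim) : nat :=
  comp_mult
    (section_repr (capmx_module (pim_module P) (right_annihilator_module radFN))
                  (pim_module P))
    (head Q).

(* Multiplicity of the head of Q in P / P J(F[N]). *)
Definition cartan_mod_radFN (P Q : pim) : nat :=
  comp_mult (section_repr (mul_radFN_module P) (pim_module P)) (head Q).

Definition head_of_quotient (P : pim) : bool := N \subset rker (head P).

(* Multiplicity of the head of Q in the projective F[G/N]-cover of the head of
   P, both heads being regarded as F[G/N]-modules. *)
Definition cartan_quotient (P Q : pim)
    (hP : head_of_quotient P) (hQ : head_of_quotient Q) : nat :=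
  cover_mult (quo_repr hP nNG) (quo_repr hQ nNG).

End NormalSubgroup.

End GroupAlgebra.

Arguments complete_pims {F gT G l} P.

(* Main.v *)
Require Import Defs.
From mathcomp Require Import all_boot all_order all_algebra all_fingroup.
From mathcomp Require Import mxrepresentation.
From mathcomp Require Import boolp.

(* Let Z be the sum over y in N of chi(y^-1) y, where chi is the sum of the traces
   of the distinct irreducible representations of N.  Since G permutes these, Z
   is central in F[G]; since F splits N, the trace form of chi is nondegenerate
   on F[N] / J, so multiplication by Z has kernel F[G]J and hence, F[G] being a
   symmetric algebra, image I.  Therefore P_i / P_i J is isomorphic to P_i \cap I,
   and c_ij = a_ij + x_ij for all i and j.
   An element of F[N] acting as 1 on the trivial module and as 0 on the other
   irreducible modules of N is a G-invariant idempotent modulo J, so it splits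
   P_i / P_i J; as P_i has a unique maximal submodule, N acts trivially on
   P_i / P_i J when P_i is in S_1, and no composition factor of P_i / P_i J is
   trivial on N when P_i is in S_2.  This gives a_ij = 0 for P_i in S_2 and P_j
   in S_1, and shows that P_i / P_i J is the projective F[G/N]-cover of the head
   of P_i when P_i is in S_1. *)

Set Implicit Arguments.
Unset Strict Implicit.
Unset Printing Implicit Defensive.

Import GRing.Theory.
Local Open Scope ring_scope.

(** * Sections and composition multiplicities *)

Section Homomorphisms.

Variables (F : fieldType) (gT : finGroupType) (G : {group gT}).

(** Multiplicities are handled as ranks. If e is an idempotent generating the right ideal Q, then
    over a splitting field e has rank 1 on the head of Q and rank 0 on every other simple module,
    and this rank is additive along a composition series. So the multiplicity of the head of Q in a
    module M is the dimension of M e, and c = a + x becomes rank-nullity for Z on P_i e, without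
    matching composition series. In chi each irreducible representation is taken once, because a
    multiplicity divisible by p would make the form degenerate. Traces with values in F suffice,
    since the trace form of a full matrix algebra is nondegenerate over any field. The separating
    element eps of F[N] is G-invariant only modulo J, so P eps need not be a submodule; the argument
    works with PJ + P eps instead. *)

Lemma gring_mx_sum n (rG : mx_representation F G n) a :
  gring_mx rG a = \sum_(x in G) a 0 (gring_index G x) *: rG x.
Proof.
rewrite /gring_mx /= mulmx_sum_row linear_sum.
rewrite (reindex (@enum_val _ (mem G))) /=; last first.
  exact: enum_val_bij_in (group1 G).
apply: eq_big => [i | i _]; first by rewrite enum_valP.
by rewrite rowK linearZ /= mxvecK gring_valK.
Qed.

Lemma gring_mxB n (rG : mx_representation F G n) a b :
  gring_mx rG (a - b) = gring_mx rG a - gring_mx rG b.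
Proof. exact: linearB. Qed.

(** The intertwining is asked on [W] only, because the projection of [V] onto a section respects the
    action on [V] but not on the whole space. *)
Lemma gring_mx_hom n1 n2 (r1 : mx_representation F G n1)
    (r2 : mx_representation F G n2) m (W : 'M_(m, n1)) f a :
    (forall x, x \in G -> W *m r1 x *m f = W *m f *m r2 x) ->
  W *m gring_mx r1 a *m f = W *m f *m gring_mx r2 a.
Proof.
move=> homf; rewrite !gring_mx_sum !mulmx_sumr mulmx_suml.
apply: eq_bigr => x Gx.
by rewrite -!scalemxAr -scalemxAl homf.
Qed.

Lemma repr_hom_gring n1 n2 (r1 : mx_representation F G n1)
    (r2 : mx_representation F G n2) f a :
  repr_hom r1 r2 f -> gring_mx r1 a *m f = f *m gring_mx r2 a.
Proof.
move=> homf; have := @gring_mx_hom _ _ r1 r2 _ 1%:M f a.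
by rewrite !mul1mx; apply=> x Gx; rewrite !mul1mx homf.
Qed.

Lemma repr_hom_module n1 n2 (r1 : mx_representation F G n1)
    (r2 : mx_representation F G n2) f m (W : 'M_(m, n1)) :
  repr_hom r1 r2 f -> mxmodule r1 W -> mxmodule r2 (W *m f).
Proof.
move=> homf modW; apply/mxmoduleP=> x Gx.
by rewrite -mulmxA -homf // mulmxA submxMr // (mxmoduleP modW).
Qed.

Lemma irr_full n (rG : mx_representation F G n) m (W : 'M_(m, n)) :
  mx_irreducible rG -> mxmodule rG W -> W != 0 -> row_full W.
Proof.
case/mx_irrP=> _ irrG modW nzW; rewrite -sub1mx -(genmxE W) sub1mx.
apply: irrG; first by rewrite (eqmx_module _ (genmxE W)).
by rewrite -mxrank_eq0 genmxE mxrank_eq0.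
Qed.

Lemma irr_hom_rsim n1 n2 (r1 : mx_representation F G n1)
    (r2 : mx_representation F G n2) f :
    mx_irreducible r1 -> mx_irreducible r2 -> repr_hom r1 r2 f -> f != 0 ->
  mx_rsim r1 r2.
Proof.
move=> irr1 irr2 homf nzf.
have fullf : row_full f.
  apply: (irr_full irr2) nzf.
  by rewrite -[f]mul1mx; apply: repr_hom_module homf (mxmodule1 _).
have freef : row_free f.
  rewrite -kermx_eq0; apply/negPn/negP => nzk.
  have modk : mxmodule r1 (kermx f).
    apply/mxmoduleP=> x Gx; apply/sub_kermxP.
    by rewrite -mulmxA homf // mulmxA mulmx_ker mul0mx.
  have := irr_full irr1 modk nzk; rewrite -sub1mx => /sub_kermxP.
  by rewrite mul1mx => f0; rewrite f0 eqxx in nzf.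
exists f => //; move: fullf freef; rewrite /row_full /row_free => /eqP->.
by move/eqP.
Qed.

End Homomorphisms.

Section Sections.

Variables (F : fieldType) (gT : finGroupType) (G : {group gT}).
Variables (n : nat) (rG : mx_representation F G n) (U V : 'M[F]_n).

(* sec_val lifts the coordinates of the section V / U to V, and sec_in maps
   vectors of V to the coordinates of their class. *)
Definition sec_val : 'M_(_, n) :=
  val_factmod (val_submod (1%:M : 'M_(\rank <<in_factmod U V>>%MS))).
Definition sec_in : 'M_(n, _) :=
  in_submod <<in_factmod U V>>%MS (in_factmod U 1%:M).

Lemma mul_sec_in m (W : 'M_(m, n)) :
  W *m sec_in = in_submod <<in_factmod U V>>%MS (in_factmod U W).
Proof. by rewrite /sec_in /in_submod /in_factmod /= mul1mx !mulmxA. Qed.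

Lemma sec_valK : sec_val *m sec_in = 1%:M.
Proof. by rewrite mul_sec_in val_factmodK val_submodK. Qed.

Lemma sec_in_eq0 m (W : 'M_(m, n)) :
  (W <= V)%MS -> (W *m sec_in == 0) = (W <= U)%MS.
Proof.
move=> sWV; rewrite mul_sec_in -in_factmod_eq0 -mxrank_eq0 mxrank_in_submod.
  by rewrite mxrank_eq0.
by rewrite genmxE submxMr.
Qed.

Hypothesis sUV : (U <= V)%MS.

Lemma sec_in0 m (W : 'M_(m, n)) : (W <= U)%MS -> W *m sec_in = 0.
Proof. by move=> sWU; apply/eqP; rewrite sec_in_eq0 ?(submx_trans sWU). Qed.

Lemma sec_val_sub : (sec_val <= V)%MS.
Proof.
rewrite -(in_factmodsK sUV) /sec_val.
apply: submx_trans (addsmxSr _ _); rewrite val_factmodS.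
by apply: submx_trans (val_submodP _) _; rewrite genmxE.
Qed.

Lemma sec_inK m (W : 'M_(m, n)) :
  (W <= V)%MS -> (W - W *m sec_in *m sec_val <= U)%MS.
Proof.
move=> sWV; rewrite -sec_in_eq0; last first.
  by rewrite addmx_sub // -mulNmx mulmx_sub ?sec_val_sub.
by rewrite mulmxBl -(mulmxA _ sec_val) sec_valK mulmx1 subrr.
Qed.

Lemma sec_in_full : row_full (V *m sec_in).
Proof. by rewrite -sub1mx -sec_valK submxMr ?sec_val_sub. Qed.

Variables (modU : mxmodule rG U) (modV : mxmodule rG V).

Lemma sec_inJ m (W : 'M_(m, n)) x :
  x \in G -> (W <= V)%MS ->
  W *m rG x *m sec_in = W *m sec_in *m section_repr modU modV x.
Proof.
move=> Gx sWV; rewrite !mul_sec_in in_factmodJ //.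
rewrite (in_submodJ (section_module modU modV)) //.
by rewrite genmxE submxMr.
Qed.

Lemma sec_in_gring m (W : 'M_(m, n)) a :
  (W <= V)%MS ->
  W *m gring_mx rG a *m sec_in =
    W *m sec_in *m gring_mx (section_repr modU modV) a.
Proof. by move=> sWV; apply: gring_mx_hom => x Gx; apply: sec_inJ. Qed.

Lemma sec_valE x : x \in G ->
  section_repr modU modV x = sec_val *m rG x *m sec_in.
Proof. by move=> Gx; rewrite sec_inJ ?sec_val_sub // sec_valK mul1mx. Qed.

Section HomFromSection.

Variables (k : nat) (rS : mx_representation F G k) (f : 'M[F]_(n, k)).
Hypotheses (Uf : U *m f = 0)
  (Vf : forall x, x \in G -> V *m rG x *m f = V *m f *m rS x).

Let Vf' m (W : 'M_(m, n)) x :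
  (W <= V)%MS -> x \in G -> W *m rG x *m f = W *m f *m rS x.
Proof. by move=> /submxP[w ->] Gx; rewrite -!(mulmxA w) Vf. Qed.

Lemma sec_in_hom m (W : 'M_(m, n)) :
  (W <= V)%MS -> W *m sec_in *m (sec_val *m f) = W *m f.
Proof.
move=> sWV; apply/esym/eqP; rewrite mulmxA -subr_eq0 -mulmxBl.
by have /submxP[w ->] := sec_inK sWV; rewrite -mulmxA Uf mulmx0.
Qed.

Lemma section_hom : repr_hom (section_repr modU modV) rS (sec_val *m f).
Proof.
move=> x Gx; rewrite sec_valE // -Vf' ?sec_val_sub // sec_in_hom //.
by apply: mxmodule_trans => //; apply: sec_val_sub.
Qed.

End HomFromSection.

End Sections.

(** * Composition multiplicities as ranks of an idempotent *)

Section Multiplicity.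

Variables (F : fieldType) (gT : finGroupType) (G : {group gT}).
Local Notation aG := (regular_repr F G).
Variable e : 'rV[F]_(gcard G).
Hypothesis idem_e : e *m gring_mx aG e = e.

Lemma gring_mx_idem n (rG : mx_representation F G n) :
  gring_mx rG e *m gring_mx rG e = gring_mx rG e.
Proof. by rewrite -gring_mxA idem_e. Qed.

Lemma gring_mx_module n (rG : mx_representation F G n) m (U : 'M_(m, n)) a :
  mxmodule rG U -> (U *m gring_mx rG a <= U)%MS.
Proof.
move=> modU; apply: (mxmodule_envelop modU) (submx_refl _).
exact: (gring_mxP rG).
Qed.

(** Acting by an idempotent is exact: the kernel of V e -> (V / U) e is V e meet U, whose vectors
    are fixed by e and hence lie in U e. *)
Lemma rank_section n (rG : mx_representation F G n) (U V : 'M_n)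
    (modU : mxmodule rG U) (modV : mxmodule rG V) :
    (U <= V)%MS ->
  \rank (V *m gring_mx rG e) =
    (\rank (U *m gring_mx rG e) +
       \rank (gring_mx (section_repr modU modV) e))%N.
Proof.
move=> sUV; rewrite -(mxrank_mul_ker (V *m _) (sec_in U V)) addnC.
congr (_ + _)%N; last first.
  by rewrite (sec_in_gring modU modV) // (eqmxMfull _ (sec_in_full sUV)).
have sVE: (V *m gring_mx rG e <= V)%MS := gring_mx_module e modV.
apply: eqmx_rank; apply/andP; split.
  apply/rV_subP=> w; rewrite sub_capmx => /andP[wVE wk].
  have wE : w *m gring_mx rG e = w.
    by case/submxP: wVE => v ->; rewrite -!mulmxA gring_mx_idem.
  rewrite -wE submxMr // -(sec_in_eq0 U (submx_trans wVE sVE)).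
  exact/eqP/sub_kermxP.
rewrite sub_capmx submxMr //=; apply/sub_kermxP/sec_in0 => //.
exact: gring_mx_module.
Qed.

Lemma rank_gring_rsim n1 n2 (r1 : mx_representation F G n1)
    (r2 : mx_representation F G n2) :
  mx_rsim r1 r2 -> \rank (gring_mx r1 e) = \rank (gring_mx r2 e).
Proof.
case=> B eqn; move: eqn r2 B => <- r2 B freeB homB.
rewrite -(mxrankMfree _ freeB) (repr_hom_gring e homB).
by rewrite eqmxMfull // row_full_unit -row_free_unit.
Qed.

Lemma rank_submod n (rG : mx_representation F G n) (U : 'M_n)
    (modU : mxmodule rG U) :
  \rank (gring_mx (submod_repr modU) e) = \rank (U *m gring_mx rG e).
Proof.
have free_val : row_free (val_submod 1%:M : 'M_(\rank U, n)).
  by rewrite /row_free val_submod1.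
rewrite -(mxrankMfree _ free_val) (@repr_hom_gring _ _ _ _ _ _ rG) ?val_submod1.
  by apply/eqmx_rank/eqmxP/eqmxMr; apply: val_submod1.
by move=> x Gx; rewrite -val_submodE -[X in val_submod X]mul1mx val_submodJ.
Qed.

(** Each composition factor adds to the rank of [e] exactly its contribution to the count, by
    [rank_section]. *)
Lemma comp_mult_rank k (rS : mx_representation F G k) :
    (forall m (rT : mx_representation F G m), mx_irreducible rT ->
      \rank (gring_mx rT e) = `[< mx_rsim rT rS >]) ->
  forall n (rG : mx_representation F G n),
    comp_mult rG rS = \rank (gring_mx rG e).
Proof.
move=> rank_e n rG; rewrite /comp_mult; case: (cid _) => Us /= [compU lastU].
rewrite /series_mult; move: (proj1 _) => {}compU.
set E := gring_mx rG e.
have telescope m : (m <= size Us)%N ->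
    \rank ((0 :: Us)`_m *m E) =
      \sum_(i < m) nat_of_bool `[< mx_rsim (series_repr i compU) rS >].
  elim: m => [|m IHm] ltm; first by rewrite big_ord0 /= mul0mx mxrank0.
  rewrite big_ord_recr -IHm 1?ltnW //= -rank_e; last exact: mx_series_repr_irr.
  rewrite (rank_section (mx_subseries_module' m (proj1 compU))
             (mx_subseries_module m (proj1 compU))) //.
  by have [_ /(_ m ltm)[/ltmxW]] := compU.
rewrite -telescope // -last_nth; apply: eqmx_rank.
by apply/eqmxP/(eqmx_trans (eqmxMr E lastU)); rewrite mul1mx.
Qed.

End Multiplicity.

(** * The radical and the irreducible representations *)

Section OrbitMap.

Variables (F : fieldType) (gT : finGroupType) (G : {group gT}).
Local Notation aG := (regular_repr F G).

Definition gring_one : 'rV[F]_(gcard G) := gring_row 1%:M.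

Lemma gring_oneM a : gring_one *m gring_mx aG a = a.
Proof. by rewrite -gring_row_mul mul1mx gring_mxK. Qed.

Lemma gring_mx_one n (rG : mx_representation F G n) :
  gring_mx rG gring_one = 1%:M.
Proof. exact: gring_op1. Qed.

(** The homomorphism from the regular module that sends 1 to [s]; its kernel is the annihilator of
    [s]. *)
Definition orbit_mx n (rG : mx_representation F G n) (s : 'rV_n) :
    'M_(gcard G, n) :=
  lin1_mx (mulmx s \o gring_mx rG).

Lemma mul_orbit_mx n (rG : mx_representation F G n) s a :
  a *m orbit_mx rG s = s *m gring_mx rG a.
Proof.
by rewrite mul_rV_lin1.
Qed.

Lemma orbit_mx_hom n (rG : mx_representation F G n) s :
  repr_hom aG rG (orbit_mx rG s).
Proof.
move=> x Gx; apply/row_matrixP=> i; rewrite !rowE !mulmxA !mul_orbit_mx.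
by rewrite gring_mxJ // mulmxA.
Qed.

Lemma orbit_mx_full n (rG : mx_representation F G n) s :
  mx_irreducible rG -> s != 0 -> row_full (orbit_mx rG s).
Proof.
move=> irrG nzs; apply: irr_full irrG _ _.
  rewrite -[orbit_mx _ _]mul1mx.
  exact: repr_hom_module (orbit_mx_hom rG s) (mxmodule1 _).
apply: contraNneq nzs => o0.
by rewrite -[s]mulmx1 -(gring_mx_one rG) -mul_orbit_mx o0 mulmx0.
Qed.

Lemma irr_transitive n (rG : mx_representation F G n) (s t : 'rV_n) :
  mx_irreducible rG -> s != 0 -> exists a, s *m gring_mx rG a = t.
Proof.
move=> irrG nzs; have /submxP[a ->] := submx_full t (orbit_mx_full irrG nzs).
by exists a; rewrite mul_orbit_mx.
Qed.

End OrbitMap.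

Arguments gring_one {F gT G}.

Section RadicalOfEnvelop.

Variables (F : fieldType) (gT : finGroupType) (G : {group gT}).
Variables (n : nat) (rA : mx_representation F G n).
Local Notation aG := (regular_repr F G).
Local Notation R := (enveloping_algebra_mx rA).
Hypothesis freeR : row_free R.

Lemma mem_gring_mx_free m a (M : 'M_(m, gcard G)) :
  (gring_mx rA a \in M *m R)%MS = (a <= M)%MS.
Proof. by rewrite /gring_mx /= vec_mxK submxMfree. Qed.

Lemma envelop_gring A : (A \in R)%MS -> exists a, A = gring_mx rA a.
Proof. by case/submxP=> a Aa; exists a; rewrite /gring_mx /= -Aa mxvecK. Qed.

Lemma sub_envelop_gring m (M : 'M_(m, gcard G)) A :
  (A \in M *m R)%MS -> exists2 a, (a <= M)%MS & A = gring_mx rA a.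
Proof.
move=> MA; have [a Aa] := envelop_gring (submx_trans MA (submxMl _ _)).
by exists a => //; rewrite -mem_gring_mx_free -Aa.
Qed.

Let R1 : (1%:M \in R)%MS. Proof. exact: envelop_mx1. Qed.

(** The quotient by the annihilator of a nonzero vector of a simple module is that module. *)
Lemma orbit_ker_maximal k (rS : mx_representation F G k) (s : 'rV_k) :
    mx_irreducible rS -> s != 0 ->
  maximal_right_ideal R <<kermx (orbit_mx rS s) *m R>>%MS.
Proof.
move=> irrS nzs; set K := kermx _.
have memK a : (gring_mx rA a \in <<K *m R>>)%MS = (s *m gring_mx rS a == 0).
  by rewrite genmxE mem_gring_mx_free (sameP sub_kermxP eqP) mul_orbit_mx.
have sKR : (<<K *m R>> <= R)%MS by rewrite genmxE submxMl.
split=> [||L sLR rL /andP[sKL /memmx_subP nLK]].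
- rewrite /ltmx sKR; apply: contra nzs => /memmx_subP/(_ _ R1).
  by rewrite -(gring_mx_one rA) memK gring_mx_one mulmx1.
- apply/mulsmx_subP=> A B KA /envelop_gring[b ->].
  have [a defA] := envelop_gring (submx_trans KA sKR); move: KA; rewrite defA.
  rewrite -gring_mxA !memK gring_mxA mulmxA => /eqP->.
  by rewrite mul0mx.
have [A LA nKA] : exists2 A, (A \in L)%MS & ~~ (A \in <<K *m R>>)%MS.
  apply: contrapT => noA; apply: nLK => A LA; apply: contrapT => /negP nKA.
  by apply: noA; exists A.
have [a defA] := envelop_gring (submx_trans LA sLR).
(* Since A does not annihilate s, some b gives s A b = s. Then 1 - A b annihilates s, so it lies in
   L, and so does 1. *)
move: nKA; rewrite defA memK => /(irr_transitive s irrS)[b ab].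
have L1 : (1%:M \in L)%MS.
  have -> : 1%:M = (1%:M - A *m gring_mx rA b) + A *m gring_mx rA b.
    by rewrite subrK.
  rewrite linearD addmx_sub //; last first.
    by apply: (mulsmx_subP rL) => //; apply: gring_mxP.
  apply: (submx_trans _ sKL); rewrite defA -gring_mxA -(gring_mx_one rA) -linearB.
  rewrite memK [gring_mx rS _]linearB /= mulmxBr gring_mx_one mulmx1.
  by rewrite gring_mxA mulmxA ab subrr.
by apply/memmx_subP=> B RB; rewrite -[B]mul1mx; apply: (mulsmx_subP rL).
Qed.

(** The simple module is the quotient of F[G] by the preimage W of M: if a acts on it as 0, then the
    class of a = 1 a is zero. *)
Lemma maximal_right_ideal_irr (M : 'A[F]_n) : maximal_right_ideal R M ->
  exists k (rS : mx_representation F G k), mx_irreducible rS /\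
    forall a, gring_mx rS a = 0 -> (gring_mx rA a \in M)%MS.
Proof.
case=> /andP[sMR nRM] rM maxM; pose W := kermx (R *m cokermx M).
have memW a : (a <= W)%MS = (gring_mx rA a \in M)%MS.
  by rewrite (sameP sub_kermxP eqP) mulmxA -submxE /gring_mx /= vec_mxK.
have modW : mxmodule aG W.
  apply/mxmoduleP=> x Gx; apply/row_subP=> i; rewrite row_mul memW gring_mxJ //.
  by apply: (mulsmx_subP rM); rewrite -?memW ?row_sub ?envelop_mx_id.
have maxW : max_submod aG W 1%:M.
  split=> [|X [modX /andP[sWX nXW] /andP[_ n1X]]].
    rewrite /ltmx submx1; apply: contra nRM => s1W; apply/memmx_subP=> A.
    by case/envelop_gring=> a ->; rewrite -memW (submx_trans (submx1 _)).
  case/negP: n1X; have /memmx_subP/(_ _ R1) : (R <= <<X *m R>>)%MS.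
    apply: maxM; first by rewrite genmxE submxMl.
      apply/mulsmx_subP=> A B; rewrite !genmxE => /sub_envelop_gring[a Xa ->].
      case/envelop_gring=> b ->; rewrite -gring_mxA mem_gring_mx_free.
      by apply: submx_trans (submxMr _ Xa) (gring_mx_module _ modX).
    apply/andP; split.
      apply/memmx_subP=> A MA; have [a defA] := envelop_gring (submx_trans MA sMR).
      by rewrite genmxE defA mem_gring_mx_free (submx_trans _ sWX) // memW -defA.
    apply: contra nXW => /memmx_subP sXM; apply/row_subP=> i; rewrite memW.
    by apply: sXM; rewrite genmxE mem_gring_mx_free row_sub.
  rewrite genmxE -(gring_mx_one rA) mem_gring_mx_free => X1.
  apply/row_subP=> i; rewrite -[row i _]gring_oneM.
  exact: submx_trans (submxMr _ X1) (gring_mx_module _ modX).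
have irrW := (max_submodP modW (mxmodule1 aG) (submx1 _)).1 maxW.
exists _, (section_repr modW (mxmodule1 aG)); split=> // a a0; rewrite -memW.
rewrite -(sec_in_eq0 W (submx1 a)) -[a]gring_oneM.
by rewrite (sec_in_gring modW (mxmodule1 aG)) ?submx1 // a0 mulmx0.
Qed.

(** The radical as the common kernel of all irreducible representations. Freeness identifies [R]
    with the group algebra of [G], so the lemma serves both F[G] and the copy of F[N] inside
    F[G]. *)
Lemma radicalP a :
  (gring_mx rA a \in jacobson_radical R)%MS <->
  forall k (rS : mx_representation F G k), mx_irreducible rS -> gring_mx rS a = 0.
Proof.
split=> [/jacobson_radicalP[_ Ja] k rS irrS | Ja].
  apply/row_matrixP=> i; rewrite rowE linear0.
  have [-> | nzi] := eqVneq (delta_mx 0 i : 'rV[F]_k) 0; first by rewrite mul0mx.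
  have := Ja _ (orbit_ker_maximal irrS nzi).
  by rewrite genmxE mem_gring_mx_free (sameP sub_kermxP eqP) mul_orbit_mx => /eqP.
apply/jacobson_radicalP; split=> [|M]; first exact: gring_mxP.
by case/maximal_right_ideal_irr=> k [rS [irrS]]; apply; apply: Ja.
Qed.

End RadicalOfEnvelop.

(** * Representatives of the irreducible modules and density *)

Section Density.

Variables (F : fieldType) (gT : finGroupType) (G : {group gT}).

Lemma irr_family : exists (I : finType) (d : I -> nat)
    (phi : forall i, mx_representation F G (d i)),
  [/\ forall i, mx_irreducible (phi i),
      forall i j, mx_rsim (phi i) (phi j) -> i = j
    & forall n (rS : mx_representation F G n), mx_irreducible rS ->
        exists i, mx_rsim rS (phi i)].
Proof.
have [U [compU lastU]] := full_series_exists (regular_repr F G).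
pose s (i j : 'I_(size U)) :=
  `[< mx_rsim (series_repr i compU) (series_repr j compU) >].
pose r i := odflt i [pick j | s i j].
(* r picks a member of the similarity class of i depending only on that class, so its fixed points
   form a set of representatives. *)
have rP i : s i (r i).
  rewrite /r; case: pickP => //= /(_ i); rewrite /s.
  by move/asboolP=> []; apply: mx_rsim_refl.
have r_eq i j : s i j -> r i = r j.
  move=> sij; rewrite /r; have eqs : s i =1 s j.
    move=> k; apply/asboolP/asboolP; apply: mx_rsim_trans; last exact/asboolP.
    by apply: mx_rsim_sym; apply/asboolP.
  rewrite (eq_pick eqs); case: pickP => //= /(_ j); rewrite /s.
  by move/asboolP=> []; apply: mx_rsim_refl.
pose I := {i : 'I_(size U) | r i == i}.
exists I, _, (fun i : I => series_repr (val i) compU); split.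
- by move=> i; apply: mx_series_repr_irr.
- move=> i j /asboolP/r_eq; rewrite (eqP (valP i)) (eqP (valP j)).
  exact: val_inj.
move=> n rS irrS; have [i simi] := rsim_regular_series irrS compU lastU.
have rri : r (r i) == r i by rewrite eq_sym; apply/eqP/r_eq/rP.
exists (exist _ (r i) rri); apply: mx_rsim_trans simi _.
by apply/asboolP; apply: rP.
Qed.

Lemma abs_irr_surj n (rG : mx_representation F G n) B :
  mx_absolutely_irreducible rG -> exists a, gring_mx rG a = B.
Proof.
case/andP=> _ fullE; have /submxP[a Ba] := submx_full (mxvec B) fullE.
by exists a; rewrite /gring_mx /= -Ba mxvecK.
Qed.

(* r2 factors through the full matrix algebra of r1, whose rows are all similar
   to r1. *)
Lemma irr_annihilator_rsim n1 n2 (r1 : mx_representation F G n1)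
    (r2 : mx_representation F G n2) :
    mx_absolutely_irreducible r1 -> mx_irreducible r2 ->
    (forall a, gring_mx r1 a = 0 -> gring_mx r2 a = 0) ->
  mx_rsim r1 r2.
Proof.
move=> abs1 irr2 ker12; set E1 := enveloping_algebra_mx r1.
set E2 := enveloping_algebra_mx r2.
have : (E2^T <= E1^T)%MS.
  rewrite submxE -[E2^T](trmxK) trmxK; apply/eqP/trmx_inj.
  rewrite trmx_mul trmxK trmx0; apply/row_matrixP=> i; rewrite row_mul row0.
  apply: (can_inj vec_mxK); rewrite linear0; apply: ker12.
  rewrite /gring_mx /= -row_mul -/E1.
  by rewrite -[E1]trmxK -trmx_mul trmxK mulmx_coker trmx0 row0 linear0.
case/submxP=> D /(congr1 trmx); rewrite trmx_mul !trmxK => defE2.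
(* The inclusion of kernels gave E2 = E1 D^T, so theta is the induced map from the full matrix
   algebra, the image of r1, to the image of r2. *)
pose theta (A : 'M_n1) : 'M_n2 := vec_mx (mxvec A *m D^T).
have thetaE a : theta (gring_mx r1 a) = gring_mx r2 a.
  by rewrite /theta /gring_mx /= vec_mxK -mulmxA -/E1 -defE2.
have thetaM A x : x \in G -> theta (A *m r1 x) = theta A *m r2 x.
  move=> Gx; have [a <-] := abs_irr_surj A abs1.
  by rewrite -gring_mxJ // !thetaE gring_mxJ.
have theta_sum (I : finType) (c : I -> F) (A : I -> 'M_n1) :
    theta (\sum_i c i *: A i) = \sum_i c i *: theta (A i).
  rewrite /theta !linear_sum mulmx_suml linear_sum; apply: eq_bigr => i _.
  by rewrite linearZ /= -scalemxAl linearZ.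
have [j [r nz_jr]] : exists j r,
    \matrix_(i < n1) row r (theta (delta_mx j i)) != 0.
  apply: contrapT => all0; have /mx_irrP[n2_gt0 _] := irr2.
  have : theta 1%:M != 0.
    rewrite -(gring_mx_one r1) thetaE gring_mx_one -mxrank_eq0 mxrank1.
    by rewrite -lt0n.
  case/eqP; rewrite (matrix_sum_delta 1%:M) pair_bigA theta_sum big1 // => -[j i] _.
  suff -> : theta (delta_mx j i) = 0 by rewrite scaler0.
  apply/row_matrixP=> r; rewrite row0.
  have [/(congr1 (row i))|nz] :=
    eqVneq (\matrix_(i < n1) row r (theta (delta_mx j i))) 0.
    by rewrite rowK row0.
  by case: all0; exists j, r.
apply: (irr_hom_rsim (mx_abs_irrW abs1) irr2 _ nz_jr) => x Gx.
apply/row_matrixP=> i; rewrite !row_mul rowK -[RHS]row_mul -thetaM //.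
have -> : delta_mx j i *m r1 x = \sum_k r1 x i k *: delta_mx j k.
  rewrite -(mul_delta_mx (0 : 'I_1) j i) -mulmxA -rowE [row i _]row_sum_delta.
  rewrite mulmx_sumr; apply: eq_bigr => k _.
  by rewrite -scalemxAr mul_delta_mx mxE.
rewrite theta_sum linear_sum /= mulmx_sum_row; apply: eq_bigr => k _.
by rewrite linearZ rowK mxE.
Qed.

Variables (I : finType) (d : I -> nat).
Variable (phi : forall i, mx_representation F G (d i)).
Hypotheses (splitG : group_splitting_field F G)
  (irr_phi : forall i, mx_irreducible (phi i))
  (phi_inj : forall i j, mx_rsim (phi i) (phi j) -> i = j).

Let abs_phi i : mx_absolutely_irreducible (phi i). Proof. exact: splitG. Qed.

(* The kernels of the representations are distinct maximal ideals, hence none of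
   them contains the product of the others. *)
Lemma irr_separate k (s : seq I) : k \notin s ->
  exists2 a, gring_mx (phi k) a != 0 & forall l, l \in s -> gring_mx (phi l) a = 0.
Proof.
elim: s => [|l s IHs].
  move=> _; exists gring_one => //; rewrite gring_mx_one -mxrank_eq0 mxrank1.
  by rewrite -lt0n; case/mx_irrP: (irr_phi k).
rewrite inE negb_or => /andP[neq_kl /IHs[a nza a0]].
have [b b0 nzb] : exists2 b, gring_mx (phi l) b = 0 & gring_mx (phi k) b != 0.
  apply: contrapT => nob; case/eqP: neq_kl; apply/esym/phi_inj.
  apply: irr_annihilator_rsim => // b b0; apply: contrapT => /eqP nzb.
  by apply: nob; exists b.
have [i nzi] : exists i, row i (gring_mx (phi k) a) != 0.
  apply: contrapT => all0; case/eqP: nza; apply/row_matrixP=> i; rewrite row0.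
  by apply: contrapT => /eqP nzi; apply: all0; exists i.
have [j nzj] : exists j, row j (gring_mx (phi k) b) != 0.
  apply: contrapT => all0; case/eqP: nzb; apply/row_matrixP=> j; rewrite row0.
  by apply: contrapT => /eqP nzj; apply: all0; exists j.
(* c moves row i of a to the j-th basis vector, so row i of the product a c b is row j of b, which
   is nonzero. *)
have [c ci] := irr_transitive (delta_mx 0 j) (irr_phi k) nzi.
exists (a *m gring_mx (regular_repr F G) c *m gring_mx (regular_repr F G) b).
  rewrite !gring_mxA; apply: contraNneq nzj => /(congr1 (row i)).
  by rewrite !row_mul ci row0 rowE => ->.
move=> m; rewrite inE !gring_mxA => /predU1P[->|/a0->]; last by rewrite !mul0mx.
by rewrite b0 mulmx0.
Qed.

(** The attainable [B] form a two-sided ideal of a full matrix algebra, nonzero by [irr_separate]; a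
    nonzero entry C i j yields every matrix unit. *)
Lemma irr_density k (B : 'M_(d k)) : exists2 a, gring_mx (phi k) a = B &
  forall l, l != k -> gring_mx (phi l) a = 0.
Proof.
pose Q (A : 'M_(d k)) := exists2 a, gring_mx (phi k) a = A &
  forall l, l != k -> gring_mx (phi l) a = 0.
have Q0 : Q 0 by exists 0; rewrite ?linear0 // => l _; rewrite linear0.
have QD A1 A2 : Q A1 -> Q A2 -> Q (A1 + A2).
  move=> [a1 <- a10] [a2 <- a20]; exists (a1 + a2); rewrite ?linearD // => l nl.
  by rewrite linearD /= a10 ?a20 ?addr0.
have QM A1 A A2 : Q A -> Q (A1 *m A *m A2).
  have [a1 <-] := abs_irr_surj A1 (abs_phi k).
  have [a2 <-] := abs_irr_surj A2 (abs_phi k).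
  case=> a <- a0; pose aG := regular_repr F G.
  exists (a1 *m gring_mx aG a *m gring_mx aG a2).
    by rewrite !gring_mxA.
  by move=> l nl; rewrite !gring_mxA a0 // mulmx0 mul0mx.
have k_notin : k \notin [seq l <- enum I | l != k] by rewrite mem_filter eqxx.
have [a nza a0] := irr_separate k_notin.
have QC : Q (gring_mx (phi k) a).
  by exists a => // l nlk; apply: a0; rewrite mem_filter nlk mem_enum.
have [i [j nzij]] : exists i j, gring_mx (phi k) a i j != 0.
  apply: contrapT => all0; case/eqP: nza; apply/matrixP=> i j; rewrite [RHS]mxE.
  by apply: contrapT => /eqP nz; apply: all0; exists i, j.
rewrite -/(Q B) (matrix_sum_delta B).
elim/big_ind: _ => // r _; elim/big_ind: _ => // c _.
set C := gring_mx _ a in QC nzij.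
have CE : delta_mx 0 i *m C *m delta_mx j 0 = (C i j)%:M :> 'M_1.
  by rewrite -rowE -colE [LHS]mx11_scalar !mxE.
have -> : B r c *: delta_mx r c =
    (B r c / C i j) *: (delta_mx r i *m C *m delta_mx j c).
  rewrite -(mul_delta_mx (0 : 'I_1) r i) -(mul_delta_mx (0 : 'I_1) j c).
  rewrite -!mulmxA (mulmxA C) (mulmxA (delta_mx 0 i)) (mulmxA (delta_mx 0 i)).
  rewrite CE mul_scalar_mx -scalemxAr scalerA divfK //.
  by rewrite mul_delta_mx.
rewrite -[_ *: _]mul_scalar_mx.
by rewrite !mulmxA; apply: QM.
Qed.


End Density.

(** * Principal indecomposable modules *)

Section PrincipalIndecomposable.

Variables (F : fieldType) (gT : finGroupType) (G : {group gT}).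
Local Notation aG := (regular_repr F G).
Local Notation nG := (gcard G).

Lemma pim_proj_exists (P : pim F G) : exists f : 'M[F]_nG,
  [/\ f *m f = f, (f :=: P)%MS & repr_hom aG aG f].
Proof.
have modP := pim_module P; have [W modW defPW dxPW] := pim_summand P.
have tiPW : (P :&: W = 0)%MS by apply/mxdirect_addsP.
exists (proj_mx P W); split.
- by apply: proj_mx_proj.
- apply/eqmxP/andP; split; first by rewrite -[proj_mx _ _]mul1mx proj_mx_sub.
  by rewrite -{1}[pim_mx P](proj_mx_id tiPW) ?submxMl.
move=> x Gx; have /hom_mxP/(_ x Gx) := proj_mx_hom tiPW modP modW.
have full1 : row_full (P + W)%MS by rewrite -sub1mx defPW.
rewrite -!mulmxA => /(row_full_inj full1); exact.
Qed.

Variable P : pim F G.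

Definition pim_proj : 'M[F]_nG := sval (cid (pim_proj_exists P)).
(** The idempotent e with P = e F[G]; [pim_proj] is left multiplication by e. *)
Definition pim_gen : 'rV[F]_nG := gring_one *m pim_proj.

Lemma pim_proj_idem : pim_proj *m pim_proj = pim_proj.
Proof. by rewrite /pim_proj; case: cid => f []. Qed.

Lemma pim_projE : (pim_proj :=: P)%MS.
Proof. by rewrite /pim_proj; case: cid => f []. Qed.

Lemma pim_proj_hom : repr_hom aG aG pim_proj.
Proof. by rewrite /pim_proj; case: cid => f []. Qed.

Lemma pim_proj_sub m (W : 'M_(m, nG)) : (W *m pim_proj <= P)%MS.
Proof. by rewrite -pim_projE submxMl. Qed.

Lemma pim_projK m (W : 'M_(m, nG)) : (W <= P)%MS -> W *m pim_proj = W.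
Proof. by rewrite -pim_projE => /submxP[w ->]; rewrite -mulmxA pim_proj_idem. Qed.

Lemma pim_projC a : gring_mx aG a *m pim_proj = pim_proj *m gring_mx aG a.
Proof. exact: repr_hom_gring pim_proj_hom. Qed.

Lemma pim_genM a : pim_gen *m gring_mx aG a = a *m pim_proj.
Proof. by rewrite /pim_gen -mulmxA -pim_projC mulmxA gring_oneM. Qed.

Lemma pim_gen_sub : (pim_gen <= P)%MS.
Proof. exact: pim_proj_sub. Qed.

Lemma pim_gen_idem : pim_gen *m gring_mx aG pim_gen = pim_gen.
Proof. by rewrite pim_genM pim_projK ?pim_gen_sub. Qed.

Lemma pim_gen_generates m (U : 'M_(m, nG)) :
  mxmodule aG U -> (pim_gen <= U)%MS -> (P <= U)%MS.
Proof.
move=> modU sU; apply/row_subP=> i.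
rewrite -(pim_projK (row_sub i P)) -pim_genM.
exact: submx_trans (submxMr _ sU) (gring_mx_module _ modU).
Qed.

Lemma pim_nz : pim_mx P != 0.
Proof. by have [] := pim_indecomposable P. Qed.

(** Once the rank of P a^k is minimal, P is the direct sum of P a^k and the kernel of a^k in P;
    indecomposability makes one of them zero. *)
Lemma pim_Fitting (a : 'M[F]_nG) : repr_hom aG aG a -> (P *m a <= P)%MS ->
  (exists k, P *m a ^+ k = 0) \/ (P :&: kermx a = 0)%MS.
Proof.
move=> hom_a sPa; have modP := pim_module P.
have hom_ak k : repr_hom aG aG (a ^+ k).
  elim: k => [|k IHk] x Gx; first by rewrite mulmx1 mul1mx.
  by rewrite exprS -mulmxE mulmxA hom_a // -!mulmxA IHk.
have sPak k : (P *m a ^+ k <= P)%MS.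
  elim: k => [|k IHk]; first by rewrite mulmx1.
  by rewrite exprSr -mulmxE mulmxA (submx_trans (submxMr _ IHk)).
have [|k0 /eqP rk0 min_k0] :=
    @ex_minnP (fun r => `[< exists k, \rank (P *m a ^+ k) = r >]).
  by exists (\rank (P *m a ^+ 0)); apply/asboolP; exists 0%N.
move/eqP: rk0 => /asboolP[k1 rk1].
have rkP j : \rank (P *m a ^+ (k1 + j)) = k0.
  apply/eqP; rewrite eqn_leq -{1}rk1 exprD -mulmxE mulmxA mxrankM_maxl /=.
  apply: min_k0; apply/asboolP; exists (k1 + j)%N.
  by rewrite exprD -mulmxE mulmxA.
(* The successor makes k positive, so that the kernel of a lies in that of a^k. *)
pose k := k1.+1; pose V := P *m a ^+ k; pose W := (P :&: kermx (a ^+ k))%MS.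
have modV : mxmodule aG V by apply: repr_hom_module (hom_ak k) modP.
have modW : mxmodule aG W.
  apply/mxmoduleP=> x Gx; rewrite sub_capmx mxmodule_trans ?capmxSl //=.
  apply/sub_kermxP; rewrite -mulmxA hom_ak // mulmxA.
  by have /sub_kermxP-> := capmxSr P (kermx (a ^+ k)); rewrite mul0mx.
have dxVW : (V :&: W = 0)%MS.
  apply/eqP; rewrite -submx0 capmxA.
  rewrite (submx_trans (capmxS (capmxSl _ _) (submx_refl _))) //.
  have := mxrank_mul_ker V (a ^+ k).
  have -> : \rank (V *m a ^+ k) = k0.
    have -> : V *m a ^+ k = P *m a ^+ (k + k) by rewrite exprD -mulmxE mulmxA.
    by rewrite /k addSnnS rkP.
  have -> : \rank V = k0 by rewrite /V /k -addn1 rkP.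
  move/eqP; rewrite -[X in _ == X]addn0 eqn_add2l mxrank_eq0 => /eqP->.
  exact: sub0mx.
have [_ indP] := pim_indecomposable P.
have [||V0|W0] := indP V W modV modW.
- apply/eqmxP; rewrite -(geq_leqif (mxrank_leqif_eq _)).
    by rewrite (mxrank_disjoint_sum dxVW) mxrank_mul_ker.
  by rewrite addsmx_sub sPak capmxSl.
- exact/mxdirect_addsP.
- by left; exists k.
right; apply/eqP; rewrite -submx0 -W0 capmxS //; apply/sub_kermxP.
by rewrite exprS -mulmxE mulmxA mulmx_ker mul0mx.
Qed.

(* If e = u + u' with u in U, u' in U', then by Fitting's lemma either left
   multiplication by u is injective on P, or it is nilpotent and left
   multiplication by u' is injective on P. *)
Lemma pim_addsmx_proper (U U' : 'M[F]_nG) :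
    mxmodule aG U -> mxmodule aG U' -> (U <= P)%MS -> (U' <= P)%MS ->
  (P <= U + U')%MS -> (P <= U)%MS \/ (P <= U')%MS.
Proof.
move=> modU modU' sUP sU'P sPUU'.
have [uu' def_e] := sub_addsmxP (submx_trans pim_gen_sub sPUU').
set u := uu'.1 *m U in def_e; set u' := uu'.2 *m U' in def_e.
pose a t := pim_proj *m orbit_mx aG t.
have hom_a t : repr_hom aG aG (a t).
  by move=> x Gx; rewrite /a mulmxA pim_proj_hom // -!mulmxA orbit_mx_hom.
have aU t (X : 'M_nG) : mxmodule aG X -> (t <= X)%MS -> (a t <= X)%MS.
  move=> modX Xt; apply/row_subP=> i; rewrite rowE mulmxA mul_orbit_mx.
  exact: submx_trans (submxMr _ Xt) (gring_mx_module _ modX).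
have inj_sub t (X : 'M_nG) : mxmodule aG X -> (X <= P)%MS -> (t <= X)%MS ->
    (P :&: kermx (a t))%MS = 0 -> (P <= X)%MS.
  move=> modX sXP Xt inj_a; rewrite -(geq_leqif (mxrank_leqif_sup sXP)).
  rewrite -(mxrank_mul_ker P (a t)) inj_a mxrank0 addn0 mxrankS //.
  exact: submx_trans (submxMl _ _) (aU _ _ modX Xt).
have aD (v : 'rV_nG) : (v <= P)%MS -> v *m a u + v *m a u' = v.
  move=> Pv; rewrite /a !mulmxA (pim_projK Pv) !mul_orbit_mx -mulmxDl -def_e.
  by rewrite pim_genM pim_projK.
have Uu : (u <= U)%MS by apply: submxMl.
have U'u' : (u' <= U')%MS by apply: submxMl.
have sPa : (P *m a u <= P)%MS.
  exact: submx_trans (submxMl _ _) (submx_trans (aU _ _ modU Uu) sUP).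
have [[k Pak0] | inj_u] := pim_Fitting (hom_a u) sPa; last first.
  by left; apply: inj_sub inj_u.
right; apply: inj_sub U'u' _ => //; apply/eqP/rowV0P=> v.
rewrite sub_capmx => /andP[Pv /sub_kermxP va0].
have va : v *m a u = v by rewrite -[RHS](aD v Pv) va0 addr0.
have <- : v *m a u ^+ k = v.
  by elim: (k) => [|j IHj]; rewrite ?mulmx1 // exprS -mulmxE mulmxA va.
by case/submxP: Pv => w ->; rewrite -mulmxA Pak0 mulmx0.
Qed.

(** A sum of two proper submodules is proper, so one of maximal rank contains all the others. *)
Lemma pim_max_submod_exists : exists M : 'M[F]_nG,
  [/\ mxmodule aG M, (M <= P)%MS, ~~ (P <= M)%MS
    & forall U : 'M_nG, mxmodule aG U -> (U <= P)%MS -> ~~ (P <= U)%MS ->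
        (U <= M)%MS].
Proof.
pose q r := `[< exists M : 'M[F]_nG,
  [/\ mxmodule aG M, (M <= P)%MS, ~~ (P <= M)%MS & \rank M = r] >].
have q0 : exists r, q r.
  exists 0%N; apply/asboolP; exists 0; rewrite mxmodule0 sub0mx submx0 pim_nz.
  by rewrite mxrank0.
have q_le r : q r -> (r <= nG)%N.
  by move=> /asboolP[M [_ _ _ <-]]; apply: rank_leq_row.
have [_ /asboolP[M [modM sMP nPM <-]] maxM] := ex_maxnP q0 q_le.
exists M; split=> // U modU sUP nPU.
have modMU := addsmx_module modM modU.
have nPMU : ~~ (P <= M + U)%MS.
  by apply/negP=> /(pim_addsmx_proper modM modU sMP sUP)[]; apply/negP.
have : (\rank (M + U)%MS <= \rank M)%N.
  by apply: maxM; apply/asboolP; exists (M + U)%MS; rewrite addsmx_sub sMP.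
rewrite (geq_leqif (mxrank_leqif_sup (addsmxSl M U))); apply: submx_trans.
exact: addsmxSr.
Qed.

Let rad_gring a : (gring_mx aG a \in radFG F G)%MS <->
  forall k (rS : mx_representation F G k), mx_irreducible rS -> gring_mx rS a = 0.
Proof. exact: radicalP (gring_free F G) a. Qed.

Let rad_mem A : (A \in radFG F G)%MS -> exists2 a, A = gring_mx aG a &
  forall k (rS : mx_representation F G k), mx_irreducible rS -> gring_mx rS a = 0.
Proof.
move=> JA; have [RA _] := (jacobson_radicalP _ _).1 JA.
have [a defA] := envelop_gring RA; exists a => //.
by apply/rad_gring; rewrite -defA.
Qed.

Notation radP := (mul_ideal P (radFG F G)).

Lemma pim_rad_max :
  [/\ (radP <= P)%MS, ~~ (P <= radP)%MS
    & forall U : 'M_nG, mxmodule aG U -> (U <= P)%MS -> ~~ (P <= U)%MS ->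
        (U <= radP)%MS].
Proof.
have modP := pim_module P.
have [M [modM sMP nPM maxM]] := pim_max_submod_exists.
have max_subM : max_submod aG M P.
  split=> [|X [modX /andP[_ nXM] /andP[sXP nPX]]]; first exact/andP.
  by case/negP: nXM; apply: maxM.
have irrM := (max_submodP modM modP sMP).1 max_subM.
have sradM : (radP <= M)%MS.
  apply: mxspan_min => _ [u [A [Pu /rad_mem[a -> a0] ->]]].
  rewrite -(@sec_in_eq0 _ _ M P).
    by rewrite (sec_in_gring modM modP) // a0 ?mulmx0.
  exact: submx_trans (submxMr _ Pu) (gring_mx_module _ modP).
(* Each v in M must act as 0 on every simple module. If s v is nonzero, some b gives s v b = s e;
   then e - v b lies in the annihilator of s in P, a proper submodule and so part of M, which puts e
   in M. *)
have sMrad : (M <= radP)%MS.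
  apply/row_subP=> i; set v := row i M; have Mv : (v <= M)%MS := row_sub i M.
  rewrite -(pim_projK (submx_trans Mv sMP)) -pim_genM; apply: mxspan_mem.
  exists pim_gen, (gring_mx aG v); split; rewrite ?pim_gen_sub //.
  apply/rad_gring=> k rS irrS; apply/row_matrixP=> j; rewrite row0 rowE.
  set s := delta_mx 0 j; apply: contrapT => /eqP nz_sv.
  have [b sb] := irr_transitive (s *m gring_mx rS pim_gen) irrS nz_sv.
  have Mvb : (v *m gring_mx aG b <= M)%MS.
    exact: submx_trans (submxMr _ Mv) (gring_mx_module _ modM).
  pose K := (P :&: kermx (orbit_mx rS s))%MS.
  have modK : mxmodule aG K.
    apply/mxmoduleP=> x Gx; rewrite sub_capmx mxmodule_trans ?capmxSl //=.
    apply/sub_kermxP; rewrite -mulmxA orbit_mx_hom // mulmxA.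
    by have /sub_kermxP-> := capmxSr P (kermx (orbit_mx rS s)); rewrite mul0mx.
  have Kevb : (pim_gen - v *m gring_mx aG b <= K)%MS.
    rewrite sub_capmx addmx_sub ?pim_gen_sub ?eqmx_opp ?(submx_trans Mvb) //=.
    apply/sub_kermxP; rewrite mul_orbit_mx linearB /= mulmxBr gring_mxA mulmxA sb.
    by rewrite subrr.
  have sKM : (K <= M)%MS.
    apply: maxM; rewrite ?capmxSl //; apply: contra nz_sv => sPK.
    have := submx_trans (submx_trans Mv sMP) (submx_trans sPK (capmxSr _ _)).
    by rewrite (sameP sub_kermxP eqP) mul_orbit_mx.
  case/negP: nPM; apply: pim_gen_generates => //.
  rewrite -[pim_gen](subrK (v *m gring_mx aG b)) addmx_sub //.
  exact: submx_trans Kevb sKM.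
split; first exact: submx_trans sradM sMP.
  by apply: contra nPM => /submx_trans->.
by move=> U modU sUP nPU; apply: submx_trans sMrad; apply: maxM.
Qed.

Lemma head_irr : mx_irreducible (Defs.head P).
Proof.
have [srP nPr maxr] := pim_rad_max.
apply/(max_submodP (mul_radFG_module P) (pim_module P) srP).
split=> [|X [modX /andP[_ nXr] /andP[sXP nPX]]]; first exact/andP.
by case/negP: nXr; apply: maxr.
Qed.

Lemma head_gen_nz : pim_gen *m sec_in radP P != 0.
Proof.
have [_ nPr _] := pim_rad_max; rewrite sec_in_eq0 ?pim_gen_sub //.
by apply: contra nPr; apply: pim_gen_generates; apply: mul_radFG_module.
Qed.

Lemma irr_kills_rad k (rS : mx_representation F G k) (s : 'rV_k) :
  mx_irreducible rS -> radP *m orbit_mx rS s = 0.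
Proof.
move=> irrS; apply/sub_kermxP/mxspan_min => _ [u [A [_ /rad_mem[a -> a0] ->]]].
by apply/sub_kermxP; rewrite mul_orbit_mx gring_mxA a0 // mulmx0 mulmx0.
Qed.

(** The image of e on a simple S is Hom(P, S) = Hom(head of P, S), of dimension at most 1 by Schur's
    lemma over a splitting field. *)
Lemma rank_gen_irr (splitG : group_splitting_field F G)
    k (rS : mx_representation F G k) : mx_irreducible rS ->
  \rank (gring_mx rS pim_gen) = `[< mx_rsim rS (Defs.head P) >].
Proof.
move=> irrS; have [srP nPr _] := pim_rad_max; set E := gring_mx rS _.
have EE : E *m E = E by apply: gring_mx_idem pim_gen_idem _ _.
pose g := pim_gen *m sec_in radP P.
pose h s := sec_val radP P *m orbit_mx rS s.
have hom_h s : repr_hom (Defs.head P) rS (h s).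
  apply: section_hom; rewrite ?irr_kills_rad // => x Gx.
  by rewrite -!mulmxA orbit_mx_hom.
have g_h s : s *m E = s -> g *m h s = s.
  move=> sE; rewrite /g /h sec_in_hom ?irr_kills_rad ?pim_gen_sub //.
  by rewrite mul_orbit_mx.
case: asboolP => [sim | nsim] /=; last first.
  apply/eqP; rewrite mxrank_eq0; apply: contrapT => /negP nzE; apply: nsim.
  have [i nzi] : exists i, row i E != 0.
    apply: contrapT => all0; case/eqP: nzE; apply/row_matrixP=> i; rewrite row0.
    by apply: contrapT => /eqP nzi; apply: all0; exists i.
  have gh : g *m h (row i E) = row i E by rewrite g_h // -row_mul EE.
  apply/mx_rsim_sym/(irr_hom_rsim head_irr irrS (hom_h (row i E))).
  by apply: contraNneq nzi => h0; rewrite -gh h0 mulmx0.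
have rank_gt0 : (0 < \rank E)%N.
  rewrite (rank_gring_rsim pim_gen sim) lt0n mxrank_eq0.
  apply: contraNneq head_gen_nz => head0; rewrite -{1}pim_gen_idem.
  rewrite (sec_in_gring (mul_radFG_module P) (pim_module P)) ?pim_gen_sub //.
  by rewrite head0 mulmx0.
have [B [B' B'B rSE]] := mx_rsim_def sim.
apply/eqP; rewrite eqn_leq rank_gt0 andbT.
apply: leq_trans (_ : \rank (g *m B') <= 1)%N; last exact: rank_leq_row.
(* Every row of E is the image of g under a homomorphism from the head, hence a scalar multiple of g
   B'. *)
apply: mxrankS; apply/row_subP=> i; set s := row i E.
have gh : g *m h s = s by rewrite g_h // -row_mul EE.
have cent : centgmx rS (B *m h s).
  apply/centgmxP=> x Gx; rewrite -mulmxA -hom_h // [X in _ = X *m _]rSE //.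
  by rewrite -!mulmxA (mulmxA B') B'B mul1mx.
have /is_scalar_mxP[c defc] := mx_abs_irr_cent_scalar (splitG _ _ irrS) cent.
rewrite -gh -[h s]mul1mx -B'B -(mulmxA B' B) defc mulmxA mul_mx_scalar.
exact: scalemx_sub.
Qed.


End PrincipalIndecomposable.

(** * The central element whose multiplication has kernel F[G]J and image I *)

Section Coefficients.

Variables (F : fieldType) (gT : finGroupType) (G : {group gT}).
Local Notation aG := (regular_repr F G).
Local Notation nG := (gcard G).

Definition gcoef (v : 'rV[F]_nG) (x : gT) : F := v 0 (gring_index G x).
Definition gelt (x : gT) : 'rV[F]_nG := delta_mx 0 (gring_index G x).

Lemma gcoefP (v w : 'rV[F]_nG) : {in G, gcoef v =1 gcoef w} -> v = w.
Proof.
move=> eqvw; apply/rowP=> i.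
by have := eqvw _ (enum_valP i); rewrite /gcoef gring_valK.
Qed.

Lemma gcoef_sum (I : Type) (r : seq I) (Q : pred I) (v : I -> 'rV[F]_nG) x :
  gcoef (\sum_(i <- r | Q i) v i) x = \sum_(i <- r | Q i) gcoef (v i) x.
Proof. by rewrite /gcoef summxE. Qed.

Lemma gcoefZ c (v : 'rV[F]_nG) x : gcoef (c *: v) x = c * gcoef v x.
Proof. by rewrite /gcoef mxE. Qed.

Lemma gcoef_elt : {in G &, forall x y, gcoef (gelt x) y = (x == y)%:R}.
Proof.
move=> x y Gx Gy; rewrite /gcoef /gelt mxE eqxx /= eq_sym.
by rewrite (inj_in_eq (can_in_inj (@gring_indexK _ G))).
Qed.

Lemma gelt_mul : {in G &, forall x y, gelt x *m aG y = gelt (x * y)%g}.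
Proof. by move=> x y Gx Gy; rewrite /gelt -rowE rowK gring_indexK. Qed.

Lemma gcoef_decomp v : v = \sum_(x in G) gcoef v x *: gelt x.
Proof.
apply: gcoefP => y Gy; rewrite gcoef_sum (bigD1 y) //= gcoefZ gcoef_elt //.
rewrite eqxx mulr1 big1 ?addr0 // => x /andP[Gx neq_xy].
by rewrite gcoefZ gcoef_elt // (negbTE neq_xy) mulr0.
Qed.

Lemma gcoef_mul v : {in G &, forall x g,
  gcoef (v *m aG x) g = gcoef v (g * x^-1)%g}.
Proof.
move=> x g Gx Gg; have Ggx : (g * x^-1 \in G)%g by rewrite groupM ?groupV.
rewrite {1}(gcoef_decomp v) mulmx_suml gcoef_sum (bigD1 (g * x^-1)%g) //=.
rewrite -scalemxAl gelt_mul // gcoefZ gcoef_elt ?groupM ?groupV // mulgKV eqxx mulr1.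
rewrite big1 ?addr0 // => y /andP[Gy neq_y].
rewrite -scalemxAl gelt_mul // gcoefZ gcoef_elt ?groupM // (canF_eq (mulgK x)).
by rewrite (negbTE neq_y) mulr0.
Qed.

Lemma gring_mx_elt n (rG : mx_representation F G n) x :
  x \in G -> gring_mx rG (gelt x) = rG x.
Proof.
by move=> Gx; rewrite /gring_mx /= /gelt -rowE rowK mxvecK gring_indexK.
Qed.

End Coefficients.

Section NormalSubgroup.

Variables (F : fieldType) (gT : finGroupType) (G N : {group gT}).
Hypotheses (nsNG : (N <| G)%g) (splitN : group_splitting_field F N).
Local Notation aG := (regular_repr F G).
Local Notation nG := (gcard G).
Let sNG : N \subset G := normal_sub nsNG.
Local Notation aGN := (subg_repr aG (normal_sub nsNG)).

Let GN y : y \in N -> y \in G. Proof. exact: (subsetP sNG). Qed.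
Let NJ x y : x \in G -> (y ^ x \in N)%g = (y \in N).
Proof. by move=> Gx; rewrite memJ_norm // (subsetP (normal_norm nsNG)). Qed.

Lemma subg_regular_free : row_free (enveloping_algebra_mx aGN).
Proof.
rewrite -kermx_eq0; apply/rowV0P=> a /sub_kermxP a0.
apply: gcoefP => y Ny.
have : gelt F G 1%g *m gring_mx aGN a = 0.
  by rewrite /gring_mx /= a0 linear0 mulmx0.
rewrite gring_mx_sum mulmx_sumr => /(congr1 (fun v => gcoef v y)).
rewrite gcoef_sum (bigD1 y) //= -scalemxAr gcoefZ gelt_mul ?GN // mul1g.
rewrite gcoef_elt ?GN // eqxx mulr1 big1 ?addr0; last first.
  move=> x /andP[Nx neq_xy]; rewrite -scalemxAr gcoefZ gelt_mul ?GN // mul1g.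
  by rewrite gcoef_elt ?GN // (negbTE neq_xy) mulr0.
by rewrite /gcoef !mxE.
Qed.

Lemma radFN_gring a : (gring_mx aGN a \in radFN F nsNG)%MS <->
  forall k (rS : mx_representation F N k), mx_irreducible rS -> gring_mx rS a = 0.
Proof. exact: radicalP subg_regular_free a. Qed.

Lemma radFN_mem A : (A \in radFN F nsNG)%MS -> exists2 a, A = gring_mx aGN a &
  forall k (rS : mx_representation F N k), mx_irreducible rS -> gring_mx rS a = 0.
Proof.
move=> JA; have [RA _] := (jacobson_radicalP _ _).1 JA.
have [a defA] := envelop_gring RA; exists a => //.
by apply/radFN_gring; rewrite -defA.
Qed.

Section ConjugateRepr.

Variables (n : nat) (r : mx_representation F N n) (x : gT).
Hypothesis Gx : x \in G.

Lemma conjg_mx_repr : mx_repr N (fun y => r (y ^ x)%g).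
Proof.
split=> [|y z Ny Nz]; first by rewrite conj1g repr_mx1.
by rewrite conjMg repr_mxM ?NJ.
Qed.
Definition conjg_repr := MxRepresentation conjg_mx_repr.

Lemma conjg_repr_irr : mx_irreducible r -> mx_irreducible conjg_repr.
Proof.
case/mx_irrP=> n_gt0 irr_r; apply/mx_irrP; split=> // U modU; apply: irr_r.
apply/mxmoduleP=> y Ny; rewrite -[y](conjgKV x).
by apply: (mxmoduleP modU); rewrite NJ ?groupV.
Qed.

End ConjugateRepr.

Variables (I : finType) (d : I -> nat).
Variable (phi : forall i, mx_representation F N (d i)).
Hypotheses (irr_phi : forall i, mx_irreducible (phi i))
  (phi_inj : forall i j, mx_rsim (phi i) (phi j) -> i = j)
  (phi_all : forall n (rS : mx_representation F N n), mx_irreducible rS ->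
     exists i, mx_rsim rS (phi i)).

Definition irr_trace y := \sum_i \tr (phi i y).
Local Notation lambda := irr_trace.

(** Conjugation by [x] permutes the isomorphism classes, so it only reorders the sum. *)
Lemma irr_traceJ x y : x \in G -> y \in N -> lambda (y ^ x)%g = lambda y.
Proof.
move=> Gx Ny.
pose s i := sval (cid (phi_all (conjg_repr_irr Gx (irr_phi i)))).
have simP i : mx_rsim (conjg_repr (phi i) Gx) (phi (s i)).
  by rewrite /s; case: cid.
have inj_s : injective s.
  move=> i j eq_s; apply: phi_inj.
  have simij : mx_rsim (conjg_repr (phi i) Gx) (conjg_repr (phi j) Gx).
    by apply: mx_rsim_trans (simP i) _; rewrite eq_s; apply: mx_rsim_sym.
  case: simij => B eqd freeB homB; exists B => // z Nz.
  by rewrite -[z](conjgKV x) homB // NJ ?groupV.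
rewrite /irr_trace [RHS](reindex_inj inj_s); apply: eq_bigr => i _.
exact: (mxtrace_rsim (simP i) Ny).
Qed.

Lemma irr_trace_gring m a : m \in N ->
  \sum_i \tr (phi i m *m gring_mx (phi i) a) =
    \sum_(y in N) gcoef a y * lambda (m * y)%g.
Proof.
move=> Nm.
under eq_bigr => i _ do rewrite gring_mx_sum mulmx_sumr linear_sum /=.
rewrite exchange_big; apply: eq_bigr => y Ny; rewrite /irr_trace mulr_sumr.
by apply: eq_bigr => i _; rewrite -scalemxAr linearZ /= repr_mxM.
Qed.

Lemma irr_trace_nondegenerate a :
    (forall m, m \in N -> \sum_(y in N) gcoef a y * lambda (m * y)%g = 0) ->
  forall k (rS : mx_representation F N k), mx_irreducible rS -> gring_mx rS a = 0.
Proof.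
move=> trace0.
have trace0' b : \sum_i \tr (gring_mx (phi i) b *m gring_mx (phi i) a) = 0.
  under eq_bigr => i _ do rewrite gring_mx_sum mulmx_suml linear_sum /=.
  rewrite exchange_big big1 //= => m Nm.
  under eq_bigr => i _ do rewrite -scalemxAl linearZ /=.
  by rewrite -mulr_sumr irr_trace_gring // trace0 // mulr0.
have phi0 i : gring_mx (phi i) a = 0.
  apply/matrixP=> r c; rewrite [RHS]mxE.
  (* The transposed matrix unit is chosen because tr (E_cr A) is the entry of A at (r, c). *)
  have [b bi b0] := irr_density splitN irr_phi phi_inj (delta_mx c r : 'M_(d i)).
  have := trace0' b; rewrite (bigD1 i) //= bi big1 ?addr0 => [|j neq_ji]; last first.
    by rewrite b0 // mul0mx linear0.
  move=> <-; rewrite -(mul_delta_mx (0 : 'I_1)) -mulmxA mxtrace_mulC -rowE -colE.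
  by rewrite /mxtrace big_ord1 !mxE.
move=> k rS irrS; have [i sim] := phi_all irrS.
have [B [B' B'B rSE]] := mx_rsim_def sim.
rewrite gring_mx_sum (eq_bigr (fun y => B *m (gcoef a y *: phi i y) *m B')).
  rewrite -mulmx_suml -mulmx_sumr -[X in B *m X](gring_mx_sum (phi i) a) phi0.
  by rewrite mulmx0 mul0mx.
by move=> y Ny; rewrite rSE // -scalemxAr -scalemxAl.
Qed.

Definition trace_mx : 'M[F]_nG := \sum_(y in N) lambda y^-1%g *: aG y.
Local Notation Z := trace_mx.

Lemma trace_mxC x : x \in G -> aG x *m Z = Z *m aG x.
Proof.
move=> Gx; rewrite /trace_mx mulmx_sumr mulmx_suml.
rewrite (reindex_acts 'J _ Gx) /=; last by rewrite astabsJ normal_norm.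
apply: eq_bigr => y Ny; have Gy := GN Ny.
rewrite -scalemxAr -scalemxAl -!repr_mxM ?groupJ //.
by rewrite -conjgC -conjVg irr_traceJ ?groupV.
Qed.

Lemma gcoef_trace_mx v g : g \in G ->
  gcoef (v *m Z) g = \sum_(y in N) gcoef v (g * y)%g * lambda y.
Proof.
move=> Gg; rewrite /trace_mx mulmx_sumr gcoef_sum [RHS](reindex_inj invg_inj).
apply: eq_big => [y | y Ny]; first by rewrite groupV.
by rewrite -scalemxAr gcoefZ (gcoef_mul v (GN Ny) Gg) mulrC.
Qed.

(** The coefficient of A Z at m is the sum over the irreducibles of tr (phi(m^-1) phi(a)), and
    phi(a) = 0. *)
Lemma trace_mx_rad A : (A \in radFN F nsNG)%MS -> A *m Z = 0.
Proof.
case/radFN_mem=> a -> a0; rewrite gring_mx_sum /trace_mx mulmx_suml.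
transitivity (\sum_(m in N)
    (\sum_(y in N) gcoef a y * lambda (m^-1 * y)%g) *: aG m).
  under [RHS]eq_bigr => m _ do rewrite scaler_suml.
  rewrite exchange_big; apply: eq_bigr => y Ny.
  rewrite -scalemxAl mulmx_sumr scaler_sumr.
  rewrite [RHS](reindex_inj (mulgI y)); apply: eq_big => [m|m Nm].
    by rewrite groupMl.
  by rewrite -scalemxAr scalerA -repr_mxM ?GN // invMg mulgKV.
rewrite big1 // => m Nm; rewrite -irr_trace_gring ?groupV // big1 ?scale0r // => i _.
by rewrite a0 // mulmx0 linear0.
Qed.

(* v is split along the left cosets tN: the component of v in tN is t times an
   element X t of F[N], and trace_mx preserves each component.  The factor q
   selects one t in each coset. *)
Lemma trace_mx_ker v : v *m Z = 0 -> exists (u : gT -> 'rV[F]_nG) X,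
  (forall t, t \in G -> (X t \in radFN F nsNG)%MS) /\
  v = \sum_(t in G) u t *m X t.
Proof.
move=> vZ; pose q t : F := (t == repr (t *: N)%g)%:R.
pose a t : 'rV[F]_(gcard N) := \row_i gcoef v (t * enum_val i)%g.
have coef_a t y : y \in N -> gcoef (a t) y = gcoef v (t * y)%g.
  by move=> Ny; rewrite [LHS]mxE gring_indexK.
exists (fun t => q t *: gelt F G t), (fun t => gring_mx aGN (a t)).
split=> [t Gt|].
  (* The pairing of a t with m is the coefficient of v Z at t m^-1. *)
  apply/radFN_gring/irr_trace_nondegenerate=> m Nm.
  have Gtm : (t * m^-1 \in G)%g by rewrite groupM ?groupV ?(GN Nm).
  transitivity (gcoef (v *m Z) (t * m^-1)%g); last by rewrite vZ /gcoef mxE.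
  rewrite gcoef_trace_mx // [RHS](reindex_inj (mulgI m)); apply: eq_big => [y|y Ny].
    by rewrite groupMl.
  by rewrite coef_a // mulgA mulgKV.
have q_sum g : g \in G -> \sum_(y in N) q (g * y^-1)%g = 1.
  move=> Gg; have : repr (g *: N)%g \in (g *: N)%g.
    exact: mem_repr (lcoset_refl _ _).
  case/lcosetP=> z Nz def_r.
  have q_eq y : y \in N -> q (g * y^-1)%g = (y == z^-1)%g%:R.
    move=> Ny; rewrite /q (_ : (g * y^-1) *: N = g *: N)%g; last first.
      by apply/lcoset_eqP; rewrite mem_lcoset mulKg groupV.
    by rewrite def_r (inj_eq (mulgI g)) (inv_eq invgK).
  rewrite (bigD1 z^-1%g) ?groupV //= q_eq ?groupV // eqxx.
  rewrite big1 ?addr0 // => y /andP[Ny nyz].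
  by rewrite q_eq // (negbTE nyz).
transitivity (\sum_(t in G) \sum_(y in N)
    (q t * gcoef v (t * y)%g) *: gelt F G (t * y)%g).
  rewrite exchange_big /=; transitivity (\sum_(y in N) \sum_(g in G)
      (q (g * y^-1)%g * gcoef v g) *: gelt F G g); last first.
    apply: eq_bigr => y Ny; rewrite (reindex_inj (mulIg y)) /=.
    apply: eq_big => [t|t _]; last by rewrite mulgK.
    by rewrite groupMr ?(GN Ny).
  rewrite exchange_big [LHS]gcoef_decomp; apply: eq_bigr => g Gg.
  by rewrite -scaler_suml -mulr_suml q_sum // mul1r.
apply: eq_bigr => t Gt; rewrite gring_mx_sum mulmx_sumr; apply: eq_bigr => y Ny.
rewrite -scalemxAr -scalemxAl gelt_mul ?(GN Ny) // scalerA.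
by rewrite -[a t 0 _]/(gcoef (a t) y) coef_a // mulrC.
Qed.

(** The spanning set is already a subspace, the kernel K of a linear map, so the span adds
    nothing. *)
Lemma annFN_mem v : (v <= annFN F nsNG)%MS <->
  forall A, (A \in radFN F nsNG)%MS -> A *m gring_mx aG v = 0.
Proof.
split=> [Iv A JA|]; last exact: mxspan_mem.
pose K := kermx (enveloping_algebra_mx aG *m lin_mulmx A).
have memK w : (w <= K)%MS = (A *m gring_mx aG w == 0).
  rewrite (sameP sub_kermxP eqP) mulmxA -[w *m _]vec_mxK mul_vec_lin /=.
  by rewrite -[RHS](inj_eq (can_inj mxvecK)) linear0.
by apply/eqP; rewrite -memK; apply: submx_trans Iv (mxspan_min _) => w Jw;
   rewrite memK; apply/eqP/Jw.
Qed.

(** Under the form (x y)_1 the image of the central Z is the orthogonal of its kernel F[G]J, and I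
    kills J on the left. So a functional vanishing on the image of Z must be shown to vanish on
    I. *)
Lemma annFN_trace_mx : (annFN F nsNG :=: Z)%MS.
Proof.
apply/eqmxP/andP; split; last first.
  apply/row_subP=> i; apply/annFN_mem=> A JA; rewrite rowE; set w := delta_mx 0 i.
  have [z defZ] : exists z, Z = gring_mx aG z.
    apply: envelop_gring; rewrite /trace_mx linear_sum summx_sub //= => y Ny.
    by rewrite linearZ scalemx_sub // envelop_mx_id ?(GN Ny).
  rewrite (_ : w *m Z = w *m gring_mx aG z) -?defZ //.
  rewrite defZ gring_mxA -defZ (@repr_hom_gring _ _ _ _ _ aG aG Z).
    by rewrite mulmxA trace_mx_rad ?mul0mx.
  by move=> x Gx; apply: trace_mxC.
apply: mxspan_min => v Jv; rewrite submxE; apply/eqP/rowP=> j; rewrite [RHS]mxE.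
set w := cokermx Z.
(* Column j of w is the functional x |-> (y x)_1 of the symmetric form. *)
have gelt_w x : (gelt F G x *m w) 0 j = w (gring_index G x) j.
  by rewrite /gelt -rowE mxE.
pose y : 'rV[F]_nG := \row_i w (gring_index G (enum_val i)^-1%g) j.
have coef_y g : g \in G -> gcoef y g = w (gring_index G g^-1%g) j.
  by move=> Gg; rewrite [LHS]mxE gring_indexK.
have yZ : y *m Z = 0.
  apply: gcoefP => g Gg; rewrite gcoef_trace_mx // [gcoef 0 _]mxE.
  transitivity ((gelt F G g^-1%g *m (Z *m w)) 0 j); last first.
    by rewrite mulmx_coker mulmx0 mxE.
  rewrite mulmxA {1}/trace_mx mulmx_sumr mulmx_suml summxE.
  have Gg' := groupVr Gg.
  rewrite [RHS](reindex_acts 'J _ Gg') /=; last by rewrite astabsJ normal_norm.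
  rewrite [LHS](reindex_inj invg_inj); apply: eq_big => [x|x]; rewrite groupV // => Nx.
  have Gx := GN Nx; rewrite -scalemxAr -scalemxAl [RHS]mxE gelt_mul ?groupJ //.
  rewrite -conjgC gelt_w coef_y ?groupM ?groupV // -conjVg irr_traceJ ?groupV //.
  by rewrite invMg invgK mulrC.
have [u [X [JX def_y]]] := trace_mx_ker yZ.
(* The functional takes at v the value (y v)_1, and y v = 0 since y is in F[G]J. *)
transitivity (gcoef (y *m gring_mx aG v) 1%g); last first.
  rewrite def_y mulmx_suml big1 => [|t Gt]; first by rewrite /gcoef mxE.
  by rewrite -mulmxA Jv ?mulmx0 //; apply: JX.
rewrite {1}(gcoef_decomp v) mulmx_suml summxE gring_mx_sum mulmx_sumr gcoef_sum.
apply: eq_bigr => x Gx; rewrite -scalemxAl mxE gelt_w -scalemxAr gcoefZ.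
by rewrite gcoef_mul ?group1 // mul1g coef_y ?groupV // invgK.
Qed.

End NormalSubgroup.

(** * The separating element of F[N] and the rank identity for P / PJ *)

Section Restriction.

Variables (F : fieldType) (gT : finGroupType) (G N : {group gT}).
Hypotheses (nsNG : (N <| G)%g) (splitN : group_splitting_field F N).
Local Notation aG := (regular_repr F G).
Local Notation nG := (gcard G).
Let sNG : N \subset G := normal_sub nsNG.
Local Notation aGN := (subg_repr aG (normal_sub nsNG)).
Local Notation J := (radFN F nsNG).

Let GN y : y \in N -> y \in G. Proof. exact: (subsetP sNG). Qed.

Lemma gring_mx_subg n (rM : mx_representation F G n) v b :
  gring_mx rM (v *m gring_mx aGN b) =
    gring_mx rM v *m gring_mx (subg_repr rM (normal_sub nsNG)) b.
Proof.
rewrite (gring_mx_sum aGN) (gring_mx_sum (subg_repr rM _)) !mulmx_sumr.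
rewrite linear_sum; apply: eq_bigr => y Ny.
by rewrite -!scalemxAr linearZ /= gring_mxJ ?(GN Ny).
Qed.

Lemma gring_mx_trivial n (rM : mx_representation F N n) b :
    (forall y, y \in N -> rM y = 1%:M) ->
  gring_mx rM b = (\sum_(y in N) gcoef b y)%:M.
Proof.
move=> triv; rewrite gring_mx_sum -scalemx1 scaler_suml.
by apply: eq_bigr => y Ny; rewrite triv.
Qed.

Lemma subg_gring_exists a : exists b, gring_mx aGN a = gring_mx aG b.
Proof.
apply: envelop_gring; rewrite gring_mx_sum linear_sum summx_sub //= => y Ny.
by rewrite linearZ scalemx_sub // envelop_mx_id ?(GN Ny).
Qed.

Fact trivial_mx_repr : mx_repr N (fun _ => 1%:M : 'M[F]_1).
Proof. by split=> [|x y _ _]; rewrite ?mulmx1. Qed.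
Let triv := MxRepresentation trivial_mx_repr.

Let irr_triv : mx_irreducible triv.
Proof. exact/mx_abs_irrW/linear_mx_abs_irr. Qed.

Lemma radFN_trivial b : (gring_mx aGN b \in J)%MS -> \sum_(y in N) gcoef b y = 0.
Proof.
move/radFN_gring/(_ _ _ irr_triv); rewrite gring_mx_trivial //.
by move/matrixP/(_ 0 0); rewrite !mxE eqxx.
Qed.

(** Density at the trivial class; coefficient sum 1 means acting as 1 on every trivial module. *)
Lemma trivial_separator : exists a : 'rV[F]_(gcard N),
  \sum_(y in N) gcoef a y = 1 /\
  forall k (rS : mx_representation F N k), mx_irreducible rS ->
    (forall y, y \in N -> rS y = 1%:M) \/ gring_mx rS a = 0.
Proof.
have [I [d [phi [irr_phi phi_inj phi_all]]]] := irr_family F N.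
have [k0 sim0] := phi_all _ _ irr_triv.
have [a a1 a0] := irr_density splitN irr_phi phi_inj (1%:M : 'M_(d k0)).
have sim_scalar c n1 n2 (r1 : mx_representation F N n1)
    (r2 : mx_representation F N n2) : mx_rsim r1 r2 ->
    gring_mx r2 a = c%:M -> gring_mx r1 a = c%:M.
  case=> B _ freeB homB a2; apply: (row_free_inj freeB).
  by rewrite /= (repr_hom_gring a homB) a2 scalar_mxC.
exists a; split=> [|k rS irrS].
  have := sim_scalar 1 _ _ _ _ sim0 a1; rewrite gring_mx_trivial //.
  by move/matrixP/(_ 0 0); rewrite !mxE eqxx.
have [i simi] := phi_all _ _ irrS; have [eqi | neqi] := eqVneq i k0.
  left=> y Ny; rewrite eqi in simi.
  apply: (mx_rsim_scalar (c := 1) Ny _ (erefl : triv y = 1%:M)).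
  exact: mx_rsim_trans sim0 (mx_rsim_sym simi).
by right; rewrite (sim_scalar 0 _ _ _ _ simi) ?raddf0 // a0 // raddf0.
Qed.

Section Pim.

Variable P : pim F G.
Local Notation PJ := (mul_ideal P J).
Let modP : mxmodule aG P := pim_module P.
Let modPJ : mxmodule aG PJ := mul_radFN_module nsNG P.

Lemma mul_radFN_sub m (W : 'M_(m, nG)) A :
  (W <= P)%MS -> (A \in J)%MS -> (W *m A <= PJ)%MS.
Proof.
move=> sWP JA; apply/row_subP=> i; rewrite row_mul; apply: mxspan_mem.
by exists (row i W), A; rewrite (submx_trans (row_sub i W)).
Qed.

Lemma subg_gring_module m (U : 'M_(m, nG)) a :
  mxmodule aG U -> (U *m gring_mx aGN a <= U)%MS.
Proof.
by move=> modU; have [b ->] := subg_gring_exists a; apply: gring_mx_module.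
Qed.

Lemma mul_radFN_le : (PJ <= P)%MS.
Proof.
apply: mxspan_min => _ [u [A [Pu /radFN_mem[a -> _] ->]]].
exact: submx_trans (submxMr _ Pu) (subg_gring_module a modP).
Qed.

(** Rank-nullity for Z on P e: the image is (P meet I) e and the kernel is (PJ) e. *)
Lemma rank_cap_annFN e : e *m gring_mx aG e = e ->
  \rank (P *m gring_mx aG e) =
    (\rank ((P :&: annFN F nsNG)%MS *m gring_mx aG e) +
     \rank (PJ *m gring_mx aG e))%N.
Proof.
move=> idem_e; set E := gring_mx aG e.
have [I [d [phi [irr_phi phi_inj phi_all]]]] := irr_family F N.
set Z := trace_mx G phi.
have ZC x : x \in G -> aG x *m Z = Z *m aG x.
  by move=> Gx; apply: trace_mxC.
have ZE a : gring_mx aG a *m Z = Z *m gring_mx aG a by apply: repr_hom_gring.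
have defI : (annFN F nsNG :=: Z)%MS by apply: annFN_trace_mx.
have fZ : Z *m pim_proj P = pim_proj P *m Z.
  rewrite /Z /trace_mx mulmx_sumr mulmx_suml; apply: eq_bigr => y Ny.
  by rewrite -scalemxAl -scalemxAr pim_proj_hom ?(GN Ny).
have defPZ : (P *m Z :=: P :&: annFN F nsNG)%MS.
  apply/eqmxP/andP; split.
    rewrite sub_capmx defI submxMl andbT.
    have [z ->] : exists z, Z = gring_mx aG z.
      apply: envelop_gring; rewrite /Z /trace_mx linear_sum summx_sub //= => y Ny.
      by rewrite linearZ scalemx_sub // envelop_mx_id ?(GN Ny).
    exact: gring_mx_module.
  apply/rV_subP=> v; rewrite sub_capmx defI => /andP[Pv /submxP[w def_v]].
  rewrite -(pim_projK Pv) def_v -mulmxA fZ mulmxA submxMr //.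
  exact: pim_proj_sub.
(* Left multiplication by the generator of P commutes with the factors in J, so projecting the
   decomposition of v moves its left factors into P. *)
have kerZ : (P :&: kermx Z <= PJ)%MS.
  apply/rV_subP=> v; rewrite sub_capmx => /andP[Pv /sub_kermxP/trace_mx_ker].
  case=> // u [X [JX def_v]]; rewrite -(pim_projK Pv) def_v mulmx_suml.
  apply: summx_sub => t Gt; have /radFN_mem[a defX _] := JX t Gt.
  have XC : X t *m pim_proj P = pim_proj P *m X t.
    by rewrite defX; have [b ->] := subg_gring_exists a; apply: pim_projC.
  rewrite -mulmxA XC mulmxA; apply: mul_radFN_sub (JX t Gt).
  exact: pim_proj_sub.
have JZ : PJ *m Z = 0.
  apply/sub_kermxP/mxspan_min => _ [u [A [_ JA ->]]]; apply/sub_kermxP.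
  by rewrite -mulmxA (trace_mx_rad irr_phi JA) ?mulmx0.
have EE := gring_mx_idem idem_e aG; rewrite -/E in EE.
have sPE : (P *m E <= P)%MS by apply: gring_mx_module.
rewrite -(mxrank_mul_ker (P *m E) Z); congr (_ + _)%N.
  rewrite -mulmxA ZE mulmxA; apply/eqmx_rank/eqmxP/eqmxMr; exact: defPZ.
apply: eqmx_rank; apply/andP; split.
  apply/rV_subP=> w; rewrite sub_capmx => /andP[wPE wk].
  have wE : w *m E = w by case/submxP: wPE => v ->; rewrite -!mulmxA EE.
  by rewrite -wE submxMr // (submx_trans _ kerZ) // sub_capmx wk (submx_trans wPE).
rewrite sub_capmx submxMr ?mul_radFN_le //=; apply/sub_kermxP.
by rewrite -mulmxA ZE mulmxA JZ mul0mx.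
Qed.

Hypothesis splitG : group_splitting_field F G.

Lemma cartanE (Q : pim F G) : cartan P Q = \rank (P *m gring_mx aG (pim_gen Q)).
Proof.
rewrite /cartan (comp_mult_rank (pim_gen_idem Q)) ?rank_submod //.
by move=> m rT irrT; apply: rank_gen_irr.
Qed.

Lemma cartan_mod_radFNE (Q : pim F G) :
  (\rank (PJ *m gring_mx aG (pim_gen Q)) + cartan_mod_radFN nsNG P Q)%N =
    cartan P Q.
Proof.
rewrite cartanE (rank_section (pim_gen_idem Q) modPJ modP) ?mul_radFN_le //.
congr (_ + _)%N; apply: (comp_mult_rank (pim_gen_idem Q)) => m rT irrT.
exact: rank_gen_irr.
Qed.

Lemma cartan_split (Q : pim F G) :
  cartan P Q = (cartan_mod_radFN nsNG P Q + cartan_mod_annFN nsNG P Q)%N.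
Proof.
have modI := capmx_module modP (right_annihilator_module J).
set E := gring_mx aG (pim_gen Q).
have defX : cartan P Q =
    (\rank ((P :&: annFN F nsNG)%MS *m E) + cartan_mod_annFN nsNG P Q)%N.
  rewrite cartanE (rank_section (pim_gen_idem Q) modI modP) ?capmxSl //.
  congr (_ + _)%N; apply/esym; rewrite /cartan_mod_annFN.
  rewrite (comp_mult_rank (pim_gen_idem Q)); last first.
    by move=> m rT irrT; apply: rank_gen_irr.
  by congr (\rank (gring_mx (section_repr _ _) _)); apply: bool_irrelevance.
rewrite defX; congr (_ + _)%N; apply/eqP; rewrite -(eqn_add2r (\rank (PJ *m E))).
by rewrite -rank_cap_annFN ?pim_gen_idem // -cartanE // addnC cartan_mod_radFNE.
Qed.

End Pim.

End Restriction.

(** * Heads on which N acts trivially *)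

Section Dichotomy.

Variables (F : fieldType) (gT : finGroupType) (G N : {group gT}).
Hypotheses (nsNG : (N <| G)%g) (splitN : group_splitting_field F N).
Local Notation aG := (regular_repr F G).
Local Notation aN := (regular_repr F N).
Local Notation nG := (gcard G).
Let sNG : N \subset G := normal_sub nsNG.
Local Notation aGN := (subg_repr aG (normal_sub nsNG)).
Local Notation J := (radFN F nsNG).

Let GN y : y \in N -> y \in G. Proof. exact: (subsetP sNG). Qed.

Variable a : 'rV[F]_(gcard N).
Hypotheses (sum_a : \sum_(y in N) gcoef a y = 1)
  (sep_a : forall k (rS : mx_representation F N k), mx_irreducible rS ->
    (forall y, y \in N -> rS y = 1%:M) \/ gring_mx rS a = 0).
Local Notation eps := (gring_mx aGN a).

Let a_trivial k (rS : mx_representation F N k) :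
  (forall y, y \in N -> rS y = 1%:M) -> gring_mx rS a = 1%:M.
Proof. by move=> triv; rewrite gring_mx_trivial // sum_a. Qed.

Lemma separator_fixed y : y \in N -> (eps *m (aG y - 1%:M) \in J)%MS.
Proof.
move=> Ny; have -> : eps *m (aG y - 1%:M) = gring_mx aGN (a *m aN y - a).
  by rewrite gring_mxB gring_mxJ // mulmxBr mulmx1.
apply/radFN_gring => k rS irrS; rewrite gring_mxB gring_mxJ //.
case: (sep_a irrS) => [-> // | ->]; first by rewrite mulmx1 subrr.
by rewrite mul0mx subrr.
Qed.

Lemma separator_idem : ((1%:M - eps) *m eps \in J)%MS.
Proof.
have -> : (1%:M - eps) *m eps = gring_mx aGN (a - a *m gring_mx aN a).
  by rewrite gring_mxB gring_mxA mulmxBl mul1mx.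
apply/radFN_gring => k rS irrS; rewrite gring_mxB gring_mxA.
by case: (sep_a irrS) => [/a_trivial-> | ->]; rewrite ?mulmx1 ?mulmx0 subrr.
Qed.

Lemma separatorJ x : x \in G -> (aG x^-1%g *m eps *m aG x - eps \in J)%MS.
Proof.
move=> Gx; have NJ y : (y ^ x \in N)%g = (y \in N).
  by rewrite memJ_norm // (subsetP (normal_norm nsNG)).
(* b is x^-1 a x; it acts on rS as a acts on the conjugate of rS, which is trivial exactly when rS
   is. *)
pose b : 'rV[F]_(gcard N) := \sum_(y in N) gcoef a y *: gelt F N (y ^ x)%g.
have gring_b k (rS : mx_representation F N k) :
    gring_mx rS b = gring_mx (conjg_repr nsNG rS Gx) a.
  rewrite [RHS]gring_mx_sum linear_sum; apply: eq_bigr => y Ny.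
  by rewrite linearZ /= gring_mx_elt ?NJ.
have -> : aG x^-1%g *m eps *m aG x - eps = gring_mx aGN (b - a).
  rewrite gring_mxB gring_b; congr (_ - _).
  rewrite !gring_mx_sum mulmx_sumr mulmx_suml; apply: eq_bigr => y Ny.
  have Gy := GN Ny; rewrite -scalemxAr -scalemxAl; congr (_ *: _).
  by rewrite -!repr_mxM ?groupM ?groupV // -mulgA -conjgE.
apply/radFN_gring => k rS irrS; rewrite gring_mxB gring_b.
have triv_conj : (forall y, y \in N -> conjg_repr nsNG rS Gx y = 1%:M) <->
    (forall y, y \in N -> rS y = 1%:M).
  split=> triv y Ny; last by apply: triv; rewrite NJ.
  by have := triv (y ^ x^-1)%g; rewrite /= conjgKV => ->; rewrite // -NJ conjgKV.
case: (sep_a irrS) => [triv | rS0].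
  by rewrite (a_trivial triv) (a_trivial (triv_conj.2 triv)) subrr.
case: (sep_a (conjg_repr_irr nsNG Gx irrS)) => [/triv_conj triv | ->].
  by rewrite (a_trivial triv) (a_trivial (triv_conj.2 triv)) subrr.
by rewrite rS0 subrr.
Qed.

Section Pim.

Variable P : pim F G.
Local Notation PJ := (mul_ideal P J).
Local Notation radP := (mul_ideal P (radFG F G)).
Let modP : mxmodule aG P := pim_module P.
Let modPJ : mxmodule aG PJ := mul_radFN_module nsNG P.
Let modrad : mxmodule aG radP := mul_radFG_module P.

(** Moving [A] past a group element costs an error in J, which [PJ] absorbs. *)
Lemma addsmx_mul_module (A : 'M_nG) :
    (forall x, x \in G -> (aG x^-1%g *m A *m aG x - A \in J)%MS) ->
  mxmodule aG (PJ + P *m A)%MS.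
Proof.
move=> AJ; apply/mxmoduleP=> x Gx; rewrite addsmxMr addsmx_sub.
rewrite (submx_trans (mxmoduleP modPJ x Gx)) ?addsmxSl //=.
have -> : P *m A *m aG x = P *m aG x *m A +
    P *m aG x *m (aG x^-1%g *m A *m aG x - A).
  by rewrite mulmxBr addrC subrK !mulmxA repr_mxK.
have sPx : (P *m aG x <= P)%MS by apply: (mxmoduleP modP).
rewrite addmx_sub //; first by rewrite (submx_trans _ (addsmxSr _ _)) ?submxMr.
by rewrite (submx_trans _ (addsmxSl _ _)) ?mul_radFN_sub ?AJ.
Qed.

(** P is the sum of P eps and P (1 - eps), and two proper submodules cannot span P. *)
Lemma separator_or :
  (P <= PJ + P *m eps)%MS \/ (P <= PJ + P *m (1%:M - eps))%MS.
Proof.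
have sPeps : (P *m eps <= P)%MS by apply: subg_gring_module.
apply: pim_addsmx_proper.
- by apply: addsmx_mul_module => x Gx; apply: separatorJ.
- apply: addsmx_mul_module => x Gx.
  have -> : aG x^-1%g *m (1%:M - eps) *m aG x - (1%:M - eps) =
      - (aG x^-1%g *m eps *m aG x - eps).
    rewrite mulmxBr mulmxBl mulmx1 -repr_mxM ?groupV // mulVg repr_mx1.
    by rewrite !opprB [LHS]addrC addrA subrK.
  by rewrite linearN eqmx_opp separatorJ.
- by rewrite addsmx_sub mul_radFN_le.
- rewrite addsmx_sub mul_radFN_le //= mulmxBr mulmx1 addmx_sub //.
  by rewrite eqmx_opp.
have {1}-> : (P : 'M_nG) = P *m eps + P *m (1%:M - eps).
  by rewrite -mulmxDr addrC subrK mulmx1.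
apply: addmx_sub_adds; exact: addsmxSr.
Qed.

Lemma separator_trivial_mod : (P <= PJ + P *m eps)%MS ->
  forall y, y \in N -> (P *m (aG y - 1%:M) <= PJ)%MS.
Proof.
move=> sP y Ny; apply: submx_trans (submxMr _ sP) _.
rewrite addsmxMr addsmx_sub; apply/andP; split.
  rewrite mulmxBr mulmx1 addmx_sub ?eqmx_opp //.
  by apply: (mxmoduleP modPJ); apply: GN.
by rewrite -mulmxA mul_radFN_sub ?separator_fixed.
Qed.

Lemma head_trivial_gring m (W : 'M_(m, nG)) b : N \subset rker (Defs.head P) ->
    (W <= P)%MS ->
  W *m gring_mx aGN b *m sec_in radP P =
    (\sum_(y in N) gcoef b y) *: (W *m sec_in radP P).
Proof.
move=> sNr sWP; rewrite gring_mx_sum mulmx_sumr mulmx_suml scaler_suml.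
apply: eq_bigr => y Ny; rewrite -scalemxAr -scalemxAl; congr (_ *: _).
rewrite (sec_inJ modrad modP) ?(GN Ny) //.
by have /rkerP[_ ->] := subsetP sNr y Ny; rewrite mulmx1.
Qed.

(** On such a head F[N] acts through coefficient sums. J and 1 - eps have sum 0, so the second case
    of [separator_or] would put P inside [radP]. *)
Lemma head_trivial_sub : N \subset rker (Defs.head P) ->
  (PJ <= radP)%MS /\ (P <= PJ + P *m eps)%MS.
Proof.
move=> sNr; have [_ nPr _] := pim_rad_max P.
have sPJr : (PJ <= radP)%MS.
  apply: mxspan_min => _ [u [A [Pu JA ->]]].
  have [b defA _] := radFN_mem JA; rewrite defA.
  have sum_b : \sum_(y in N) gcoef b y = 0.
    by apply: (radFN_trivial (nsNG := nsNG)); rewrite -defA.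
  rewrite -(@sec_in_eq0 _ _ radP P).
    by rewrite head_trivial_gring ?sum_b ?scale0r.
  exact: submx_trans (submxMr _ Pu) (subg_gring_module _ _ modP).
split=> //; case: separator_or => // sP; case/negP: nPr.
apply: submx_trans sP _; rewrite addsmx_sub sPJr /=.
rewrite -(@sec_in_eq0 _ _ radP P).
  rewrite mulmxBr mulmxBl head_trivial_gring // sum_a scale1r.
  by rewrite mulmx1 subrr.
rewrite mulmxBr mulmx1 addmx_sub // eqmx_opp; exact: subg_gring_module.
Qed.

(** If P = PJ + P eps, then [N] is trivial modulo PJ, hence on the head; in the other case (1 - eps)
    eps in J gives the claim. The alternative [P <= PJ] is separate because [radP] bounds only
    proper submodules. *)
Lemma head_nontrivial_sub : ~~ (N \subset rker (Defs.head P)) ->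
  (P <= PJ)%MS \/ (P *m eps <= PJ)%MS.
Proof.
move=> ntriv; have [srP _ maxr] := pim_rad_max P.
have [sPPJ | nPPJ] := boolP (P <= PJ)%MS; first by left.
have sPJr : (PJ <= radP)%MS by apply: maxr => //; apply: mul_radFN_le.
right; case: separator_or => sP.
  case/negP: ntriv; apply/subsetP=> y Ny; apply/rkerP; split; first exact: GN.
  rewrite /Defs.head (sec_valE srP) ?(GN Ny) // -[aG y](subrK 1%:M) mulmxDr mulmxDl.
  rewrite mulmx1 (sec_valK radP P) sec_in0 ?add0r //.
  apply: submx_trans (submxMr _ (sec_val_sub srP)) _.
  exact: submx_trans (separator_trivial_mod sP Ny) sPJr.
apply: submx_trans (submxMr _ sP) _; rewrite addsmxMr addsmx_sub.
by rewrite subg_gring_module //= -mulmxA mul_radFN_sub // separator_idem.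
Qed.

End Pim.

(* The generator e of Q lies in Q eps + QJ, so P e lies in P eps + PJ = PJ. *)
Lemma cartan_mod_radFN_eq0 (splitG : group_splitting_field F G) (P Q : pim F G) :
    ~~ (N \subset rker (Defs.head P)) -> N \subset rker (Defs.head Q) ->
  cartan_mod_radFN nsNG P Q = 0%N.
Proof.
move=> ntrivP trivQ; set E := gring_mx aG (pim_gen Q).
have EE : E *m E = E by apply: gring_mx_idem (pim_gen_idem Q) _ _.
have sPE : (P *m E <= mul_ideal P J)%MS.
  have modP := pim_module P.
  have [sPPJ | sPeps] := head_nontrivial_sub ntrivP.
    exact: submx_trans (gring_mx_module _ modP) sPPJ.
  have [_ sQ] := head_trivial_sub trivQ.
  have [b eps_b] := subg_gring_exists nsNG a.
  have gring_eps w : gring_mx aG (w *m eps) = gring_mx aG w *m eps.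
    by rewrite eps_b gring_mxA.
  have sPw w : (P *m gring_mx aG w <= P)%MS by apply: gring_mx_module.
  (* K is the space of w with P w inside PJ, written as a kernel so that membership passes from
     spanning vectors to sums. *)
  pose K := kermx (enveloping_algebra_mx aG *m lin_mulmx P *m
    lin_mulmxr (cokermx (mul_ideal P J))).
  have memK w : (w <= K)%MS = (P *m gring_mx aG w <= mul_ideal P J)%MS.
    rewrite (sameP sub_kermxP eqP) !mulmxA -[w *m _]vec_mxK !mul_vec_lin /=.
    by rewrite -(inj_eq (can_inj vec_mxK)) mxvecK linear0 submxE.
  rewrite /E -memK; apply: submx_trans (pim_gen_sub Q) (submx_trans sQ _).
  rewrite addsmx_sub; apply/andP; split.
    apply: mxspan_min => _ [u [A [_ JA ->]]]; rewrite memK.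
    have [c defA _] := radFN_mem JA; have [c' defA'] := subg_gring_exists nsNG c.
    by rewrite defA defA' gring_mxA -defA' -defA mulmxA mul_radFN_sub.
  apply/row_subP=> i; rewrite memK row_mul gring_eps mulmxA.
  exact: submx_trans (submxMr _ (sPw _)) sPeps.
apply/eqP; rewrite -(eqn_add2l (\rank (mul_ideal P J *m E))) addn0.
rewrite cartan_mod_radFNE // cartanE // -/E; apply/eqP/eqmx_rank/andP; split.
  by rewrite -{1}EE mulmxA submxMr.
exact: submxMr (mul_radFN_le _ _).
Qed.

End Dichotomy.

(** * Projective covers over the quotient group *)

Section ProjectiveCovers.

Variables (F : fieldType) (gT : finGroupType) (G : {group gT}).

(** [cover_mult] uses an unspecified cover; uniqueness lets P / PJ replace it. *)
Lemma projective_cover_rsim n1 (r1 : mx_representation F G n1)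
    n2 (r2 : mx_representation F G n2) k (rS : mx_representation F G k) :
  projective_cover r1 rS -> projective_cover r2 rS -> mx_rsim r1 r2.
Proof.
move=> [proj1 [f1 [hom1 full1 sup1]]] [proj2 [f2 [hom2 full2 sup2]]].
have [h [hom_h hf2]] := proj1 _ _ _ _ _ _ hom2 full2 hom1.
have full_im n (r : mx_representation F G n) m (r' : mx_representation F G m)
    (g : 'M_(n, m)) (f : 'M_(m, k)) : repr_hom r r' g -> row_full (g *m f) ->
    superfluous r' (kermx f) -> row_full g.
  move=> hom_g full_gf sup_f; rewrite -sub1mx -(genmxE g) sub1mx.
  apply: sup_f.
    rewrite (eqmx_module _ (genmxE g)) -[g]mul1mx.
    exact: repr_hom_module hom_g (mxmodule1 _).
  rewrite -sub1mx; apply/row_subP=> i; set w := row i _.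
  have /submxP[u def_u] := submx_full (w *m f) full_gf.
  rewrite -[w](subrK (u *m g)) addmx_sub //.
    rewrite (submx_trans _ (addsmxSr _ _)) //; apply/sub_kermxP.
    by rewrite mulmxBl def_u mulmxA subrr.
  by rewrite (submx_trans _ (addsmxSl _ _)) // genmxE submxMl.
have full_h : row_full h by apply: (full_im _ _ _ _ _ f2 hom_h); rewrite ?hf2.
have hom_1 : repr_hom r2 r2 1%:M by move=> x _; rewrite mulmx1 mul1mx.
have [s [hom_s sh]] := proj2 _ _ _ _ _ _ hom_h full_h hom_1.
have full_s : row_full s.
  by apply: (full_im _ _ _ _ _ f1 hom_s); rewrite // -hf2 mulmxA sh mul1mx.
have free_s : row_free s by apply/row_freeP; exists h.
apply/mx_rsim_sym; exists s => //.
by move/eqP: full_s => <-; apply/eqP; rewrite eq_sym.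
Qed.

End ProjectiveCovers.

Section Inflation.

Variables (F : fieldType) (gT : finGroupType) (G N : {group gT}).
Hypothesis nNG : (G \subset 'N(N))%g.

Section OneRepresentation.

Variables (n : nat) (rT : mx_representation F (G / N)%g n).

Fact infl_mx_repr : mx_repr G (fun x => rT (coset N x)).
Proof.
split=> [|x y Gx Gy]; first by rewrite morph1 repr_mx1.
by rewrite morphM ?(subsetP nNG) // repr_mxM ?mem_quotient.
Qed.
Definition infl_repr := MxRepresentation infl_mx_repr.

Lemma infl_module m (U : 'M_(m, n)) : mxmodule infl_repr U -> mxmodule rT U.
Proof.
move/mxmoduleP=> modU; apply/mxmoduleP=> _ /morphimP[x Nx Gx ->]; exact: modU.
Qed.

Lemma infl_irr : mx_irreducible rT -> mx_irreducible infl_repr.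
Proof.
case/mx_irrP=> n_gt0 irrT; apply/mx_irrP; split=> // U /infl_module.
exact: irrT.
Qed.

Lemma infl_trivial x : x \in N -> infl_repr x = 1%:M.
Proof. by move=> Nx; rewrite /= coset_id // repr_mx1. Qed.

End OneRepresentation.

Lemma quo_rsim m (rT : mx_representation F (G / N)%g m)
    k (rS : mx_representation F G k) (krS : N \subset rker rS) :
  mx_rsim rT (quo_repr krS nNG) <-> mx_rsim (infl_repr rT) rS.
Proof.
split=> -[B eqn freeB homB]; exists B => //.
  by move=> x Gx; rewrite /= homB ?mem_quotient // quo_repr_coset.
by move=> _ /morphimP[x Nx Gx ->]; rewrite quo_repr_coset // -homB.
Qed.

(** The algebra map F[G] -> F[G/N]; it carries the idempotent of Q to one that detects the head of Q
    over G/N. *)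
Definition gproj (v : 'rV[F]_(gcard G)) : 'rV[F]_(gcard (G / N)%G) :=
  \sum_(x in G) gcoef v x *: gelt F (G / N)%G (coset N x).

Lemma gring_mx_gproj m (rT : mx_representation F (G / N)%G m) v :
  gring_mx rT (gproj v) = gring_mx (infl_repr rT) v.
Proof.
rewrite [RHS]gring_mx_sum linear_sum; apply: eq_bigr => x Gx.
by rewrite linearZ /= gring_mx_elt ?mem_quotient.
Qed.

Lemma gproj_idem e : e *m gring_mx (regular_repr F G) e = e ->
  gproj e *m gring_mx (regular_repr F (G / N)%G) (gproj e) = gproj e.
Proof.
move=> idem_e; apply: (can_inj (gring_mxK (G := (G / N)%G))).
by rewrite gring_mxA gring_mx_gproj (gring_mx_idem idem_e).
Qed.

End Inflation.

Section QuotientCover.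

Variables (F : fieldType) (gT : finGroupType) (G N : {group gT}).
Hypotheses (nsNG : (N <| G)%g) (splitG : group_splitting_field F G)
  (splitN : group_splitting_field F N).
Local Notation aG := (regular_repr F G).
Local Notation nG := (gcard G).
Local Notation J := (radFN F nsNG).
Local Notation aGN := (subg_repr aG (normal_sub nsNG)).
Let nNG : (G \subset 'N(N))%g := normal_norm nsNG.
Let GN y : y \in N -> y \in G. Proof. exact: (subsetP (normal_sub nsNG)). Qed.

Variable P : pim F G.
Hypothesis trivP : N \subset rker (Defs.head P).
Local Notation PJ := (mul_ideal P J).
Local Notation radP := (mul_ideal P (radFG F G)).
Let modP : mxmodule aG P := pim_module P.
Let modPJ : mxmodule aG PJ := mul_radFN_module nsNG P.
Let sPJ : (PJ <= P)%MS := mul_radFN_le nsNG P.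
Local Notation M := (section_repr (mul_radFN_module nsNG P) (pim_module P)).

Lemma head_trivial_mod_radFN : N \subset rker M.
Proof.
have [a [sum_a sep_a]] := trivial_separator splitN.
have [_ sP] := head_trivial_sub nsNG sum_a sep_a trivP.
apply/subsetP=> y Ny; apply/rkerP; split; first exact: GN.
rewrite (sec_valE sPJ) ?(GN Ny) // -[aG y](subrK 1%:M) mulmxDr mulmxDl.
rewrite mulmx1 (sec_valK PJ P) sec_in0 ?add0r //.
apply: submx_trans (submxMr _ (sec_val_sub sPJ)) _.
exact: (separator_trivial_mod sep_a sP Ny).
Qed.

(** Elements of J have coefficient sum 0, so they kill every module inflated from G/N. *)
Lemma radFN_inflation m (rT : mx_representation F (G / N)%G m) s :
  PJ *m orbit_mx (infl_repr nNG rT) s = 0.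
Proof.
apply/sub_kermxP/mxspan_min => _ [u [A [_ JA ->]]]; apply/sub_kermxP.
have [b defA _] := radFN_mem JA; rewrite mul_orbit_mx defA gring_mx_subg.
rewrite (gring_mx_trivial b); last exact: infl_trivial.
by rewrite (radFN_trivial (nsNG := nsNG)) -?defA // raddf0 !mulmx0.
Qed.

Lemma quotient_cover_projective (krM : N \subset rker M) :
  repr_projective (quo_repr krM nNG).
Proof.
move=> m rT k rK f g hom_f full_f hom_g.
have /submxP[t def_t] := submx_full (pim_gen P *m sec_in PJ P *m g) full_f.
(* T sends v in P to t v, where t lifts the image under g of the generator; it factors through P /
   PJ because PJ acts as 0 on inflated modules. *)
pose T := pim_proj P *m orbit_mx (infl_repr nNG rT) t.
have PT0 : PJ *m T = 0.
  by rewrite /T mulmxA (pim_projK sPJ) radFN_inflation.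
have homT x : x \in G -> P *m aG x *m T = P *m T *m infl_repr nNG rT x.
  move=> Gx; rewrite /T -!mulmxA; congr (_ *m _).
  by rewrite mulmxA pim_proj_hom // -!mulmxA orbit_mx_hom.
have hom_h := section_hom sPJ modPJ modP PT0 homT.
exists (sec_val PJ P *m T); split.
  by move=> _ /morphimP[x Nx Gx ->]; rewrite quo_repr_coset // hom_h.
apply: (row_full_inj (sec_in_full sPJ)); rewrite /= mulmxA sec_in_hom //.
have homf_infl : repr_hom (infl_repr nNG rT) (infl_repr nNG rK) f.
  by move=> x Gx; apply: hom_f; apply: mem_quotient.
have homg_infl : repr_hom M (infl_repr nNG rK) g.
  by move=> x Gx; rewrite -hom_g ?mem_quotient // quo_repr_coset.
apply/row_matrixP=> i; rewrite !row_mul; set v := row i P.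
have Pv : (v <= P)%MS := row_sub i P.
transitivity (pim_gen P *m sec_in PJ P *m g *m gring_mx (infl_repr nNG rK) v).
  rewrite /T mulmxA (pim_projK Pv) mul_orbit_mx -[LHS]mulmxA.
  by rewrite (repr_hom_gring v homf_infl) mulmxA -def_t.
rewrite -mulmxA -(repr_hom_gring v homg_infl) mulmxA.
by rewrite -(sec_in_gring modPJ modP) ?pim_gen_sub // pim_genM pim_projK.
Qed.

Lemma quotient_cover (krM : N \subset rker M) :
  projective_cover (quo_repr krM nNG) (quo_repr trivP nNG).
Proof.
split; first exact: quotient_cover_projective.
have [a [sum_a sep_a]] := trivial_separator splitN.
have [sPJr _] := head_trivial_sub nsNG sum_a sep_a trivP.
have [srP nPr maxr] := pim_rad_max P.
have r0 : PJ *m sec_in radP P = 0 by apply: sec_in0.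
have hom_r x : x \in G ->
    P *m aG x *m sec_in radP P = P *m sec_in radP P *m Defs.head P x.
  by move=> Gx; apply: sec_inJ.
have hom_f := section_hom sPJ modPJ modP r0 hom_r.
set f := sec_val PJ P *m sec_in radP P in hom_f.
have inf m (W : 'M_(m, nG)) : (W <= P)%MS ->
    W *m sec_in PJ P *m f = W *m sec_in radP P.
  by move=> sWP; rewrite /f sec_in_hom.
have full_f : row_full f.
  have := sec_in_full srP; rewrite -inf // -!sub1mx => /submx_trans; apply.
  exact: submxMl.
exists f; split=> //.
  by move=> _ /morphimP[x Nx Gx ->]; rewrite !quo_repr_coset // hom_f.
(* X is the preimage of U in P. If X is proper, it lies in [radP], so U lies in the kernel of f,
   which would then be everything. *)
move=> U modU fullU; pose X := (PJ + U *m sec_val PJ P)%MS.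
have sUP : (U *m sec_val PJ P <= P)%MS by rewrite mulmx_sub ?sec_val_sub.
have sXP : (X <= P)%MS by rewrite addsmx_sub sPJ.
have modX : mxmodule aG X.
  apply/mxmoduleP=> x Gx; rewrite addsmxMr addsmx_sub.
  rewrite (submx_trans (mxmoduleP modPJ x Gx)) ?addsmxSl //=.
  set W := U *m _ *m _; have sWP : (W <= P)%MS by apply: mxmodule_trans.
  rewrite -[W](subrK (W *m sec_in PJ P *m sec_val PJ P)) addmx_sub //.
    by rewrite (submx_trans (sec_inK sPJ sWP)) ?addsmxSl.
  rewrite (submx_trans _ (addsmxSr _ _)) // submxMr //.
  rewrite (sec_inJ modPJ modP) // -(mulmxA U) sec_valK mulmx1.
  rewrite -(quo_repr_coset krM nNG) //.
  by apply: (mxmoduleP modU); apply: mem_quotient.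
have [sPX | nPX] := boolP (P <= X)%MS.
  rewrite -sub1mx; have := sec_in_full sPJ; rewrite -sub1mx => /submx_trans-> //.
  apply: submx_trans (submxMr _ sPX) _; rewrite addsmxMr addsmx_sub.
  by rewrite sec_in0 // sub0mx -mulmxA sec_valK mulmx1 submx_refl.
have sUr : (U *m sec_val PJ P <= radP)%MS.
  exact: submx_trans (addsmxSr _ _) (maxr X modX sXP nPX).
have Uf : U *m f = 0 by rewrite /f mulmxA sec_in0.
have : (1%:M <= kermx f)%MS.
  rewrite -sub1mx in fullU; apply: submx_trans fullU _.
  by rewrite addsmx_sub submx_refl andbT; apply/sub_kermxP.
move/sub_kermxP; rewrite mul1mx => f0; have /mx_irrP[r_gt0 _] := head_irr P.
by move: full_f r_gt0; rewrite f0 /row_full mxrank0 => /eqP <-.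
Qed.

Lemma cartan_quotientE (Q : pim F G) (trivQ : N \subset rker (Defs.head Q)) :
  cartan_quotient nsNG trivP trivQ = cartan_mod_radFN nsNG P Q.
Proof.
have krM := head_trivial_mod_radFN.
have cov := quotient_cover krM.
rewrite /cartan_quotient /cover_mult; case: pselect => [exP | []]; last first.
  by exists (existT _ _ (quo_repr krM nNG)).
case: (cid exP) => -[m rC] /= covC.
have idem_e := gproj_idem nNG (pim_gen_idem Q).
rewrite (comp_mult_rank idem_e); last first.
  move=> k rT irrT; rewrite gring_mx_gproj.
  rewrite (rank_gen_irr Q splitG (infl_irr nNG irrT)); congr nat_of_bool.
  by apply/asboolP/asboolP => /quo_rsim.
rewrite (rank_gring_rsim (gproj N (pim_gen Q)) (projective_cover_rsim covC cov)).
rewrite gring_mx_gproj /cartan_mod_radFN (comp_mult_rank (pim_gen_idem Q)).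
  congr (\rank _); rewrite !gring_mx_sum; apply: eq_bigr => x Gx.
  by congr (_ *: _); apply: quo_repr_coset.
by move=> k rT irrT; apply: rank_gen_irr.
Qed.

End QuotientCover.

Theorem theorem5p3 (F : fieldType) (p : nat) (charFp : p \in [pchar F])
    (gT : finGroupType) (G N : {group gT}) (nsNG : (N <| G)%g)
    (splitG : group_splitting_field F G)
    (splitN : group_splitting_field F N)
    (splitGN : group_splitting_field F (G / N)%G)
    (l : nat) (P : 'I_l -> pim F G) (complP : complete_pims P) :
  [/\ forall (i j : 'I_l)
             (Si : head_of_quotient N (P i)) (Sj : head_of_quotient N (P j)),
        cartan (P i) (P j) =
          (cartan_quotient nsNG Si Sj + cartan_mod_annFN nsNG (P i) (P j))%N,
      forall i j : 'I_l,
        ~~ head_of_quotient N (P i) -> head_of_quotient N (P j) ->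
        cartan (P i) (P j) = cartan_mod_annFN nsNG (P i) (P j)
    & forall i j : 'I_l,
        ~~ head_of_quotient N (P i) -> ~~ head_of_quotient N (P j) ->
        cartan (P i) (P j) =
          (cartan_mod_radFN nsNG (P i) (P j) +
             cartan_mod_annFN nsNG (P i) (P j))%N].
Proof.
split=> [i j Si Sj | i j ntrivi trivj | i j _ _].
- by rewrite (cartan_quotientE nsNG splitG splitN) -cartan_split.
- have [a [sum_a sep_a]] := trivial_separator splitN.
  by rewrite (cartan_split nsNG splitN) // (cartan_mod_radFN_eq0 nsNG sum_a sep_a).
- exact: cartan_split.
Qed.
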